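(* Let $Q\subseteq\mathbb R^d$ be the hypercube $(-1,1)^d$, and let $\lambda_1^{(m)}(Q)$ be the first eigenvalue of $(-\Delta)^m u=\lambda u$ in $Q$ with Dirichlet boundary conditions $u=\frac{\partial u}{\partial\nu}=\dots=\frac{\partial^{m-1}u}{\partial\nu^{m-1}}=0$ on $\partial Q$. Then $$\left[\lambda_1^{(m)}(Q)\right]^{\frac1{2m}}=\frac{2m}{e}+O(\log m),\quad\text{as } m\to\infty.$$
   Context: Here $d\ge1$ is fixed. The eigenvalue problem is understood in the weak sense in $H^m_0(Q)$; with $\nabla^m u=\Delta^j u$ if $m=2j$ and $\nabla^m u=\nabla\Delta^j u$ if $m=2j+1$, one has $\lambda_1^{(m)}(Q)=\min_{0\ne u\in H^m_0(Q)}\int_{Q}|\nabla^m u|^2\big/\int_{Q}u^2$. *)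

(* Defs.v *)
From HB Require Import structures.
From mathcomp Require Import all_boot all_order all_algebra.
From mathcomp Require Import all_classical all_reals all_analysis.

Set Implicit Arguments.
Unset Strict Implicit.
Unset Printing Implicit Defensive.
Import Order.TTheory GRing.Theory Num.Theory.
Import numFieldNormedType.Exports.
Local Open Scope classical_set_scope.
Local Open Scope ring_scope.

(* Lebesgue measure on R^n. Row vectors carry the product sigma-algebra,
   generated by the coordinates; the measure is built by induction on n. *)

Definition rV_display : measure_display -> measure_display.
Proof. exact. Qed.

Section measurable_rV.
Context {d} {T : measurableType d}.
Variable n : nat.

Let coord : 'I_n -> 'rV[T]_n -> T := fun i x => x ord0 i.

Let rV_set0 : g_sigma_preimage coord set0.
Proof. exact: sigma_algebra0. Qed.

Let rV_setC A : g_sigma_preimage coord A -> g_sigma_preimage coord (~` A).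
Proof. exact: sigma_algebraC. Qed.

Let rV_bigcup (F : _^nat) : (forall i, g_sigma_preimage coord (F i)) ->
  g_sigma_preimage coord (\bigcup_i (F i)).
Proof. exact: sigma_algebra_bigcup. Qed.

HB.instance Definition _ := @isMeasurable.Build (rV_display d)
  'rV[T]_n (g_sigma_preimage coord) rV_set0 rV_setC rV_bigcup.

Lemma measurable_coord (i : 'I_n) :
  measurable_fun [set: 'rV[T]_n] (fun x : 'rV[T]_n => x ord0 i).
Proof.
move=> _ Y mY; rewrite setTI; apply: sub_sigma_algebra => /=.
rewrite -bigcup_seq/=; exists i => /=; first by rewrite mem_index_enum.
by exists Y => //; rewrite setTI.
Qed.

Lemma measurable_fun_rV d1 (T1 : measurableType d1) (f : T1 -> 'rV[T]_n) :
  (forall i, measurable_fun [set: T1] (fun t => f t ord0 i)) ->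
  measurable_fun [set: T1] f.
Proof.
move=> mf.
suff fS : g_sigma_preimage (fun i => coord i \o f) `<=` measurable.
  move: fS; rewrite g_sigma_preimage_comp => fS _ A mA.
  by apply: fS; exists A.
apply: smallest_sub; first exact: sigma_algebra_measurable.
elim/big_ind : _ => // [A B sA sB|i _]; first by rewrite subUset.
by move=> A [B mB <-]; exact: mf.
Qed.

End measurable_rV.

Section lebesgue_measure_rV.
Variable R : realType.

Definition rV_cons n (p : 'rV[R]_n * R) : 'rV[R]_n.+1 :=
  \row_i oapp (p.1 ord0) p.2 (unlift ord0 i).

Lemma measurable_rV_cons n : measurable_fun setT (@rV_cons n).
Proof.
apply: measurable_fun_rV => i.
rewrite (_ : (fun t => _) =
    fun t : 'rV[R]_n * R => oapp (t.1 ord0) t.2 (unlift ord0 i)); last first.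
  by apply/funext => t; rewrite mxE.
case: (unlift ord0 i) => [j|] /=; last exact: measurable_snd.
apply: (@measurableT_comp _ _ _ _ _ _ (fun x : 'rV[R]_n => x ord0 j)) => //.
exact: measurable_coord.
Qed.

Section step.
Variables (n : nat) (mu : {measure set 'rV[R]_n -> \bar R}).

Definition rV_cons_measure : set 'rV[R]_n.+1 -> \bar R :=
  pushforward (mu \x @lebesgue_measure R)%E (@rV_cons n).

HB.instance Definition _ :=
  Measure.copy rV_cons_measure
    (measure_function_pushforward__canonical__measure_function_Measure
       (mu \x @lebesgue_measure R)%E (@measurable_rV_cons n)).

End step.

Fixpoint lebesgue_measure_rV n : {measure set 'rV[R]_n -> \bar R} :=
  if n is n'.+1 return {measure set 'rV[R]_n -> \bar R} then
    rV_cons_measure (lebesgue_measure_rV n')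
  else dirac (0 : 'rV[R]_0).

End lebesgue_measure_rV.

Section polyharmonic.
Variables (R : realType) (d : nat).
Local Notation Rd := 'rV[R]_d.
Local Notation mu := (@lebesgue_measure_rV R d).

Definition hypercube : set Rd := [set x | forall i, -1 < x ord0 i < 1].
Local Notation Q := hypercube.

(* partials [:: i1; ...; ik] f is d_{i1} ... d_{ik} f *)
Definition partials (s : seq 'I_d) (f : Rd -> R) : Rd -> R :=
  foldr (fun i g x => 'D_(delta_mx ord0 i) g x) f s.

(* Since 'D is total, existence of the derivatives is required separately. *)
Definition smooth (f : Rd -> R) :=
  forall s, continuous (partials s f) /\
    forall i x, derivable (partials s f) x (delta_mx ord0 i).

Definition test_function (f : Rd -> R) :=
  smooth f /\
  exists K : set Rd, [/\ compact K, K `<=` Q & forall x, ~ K x -> f x = 0].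

Definition square_integrable (f : Rd -> R) :=
  measurable_fun Q f /\ mu.-integrable Q (fun x => (f x ^+ 2)%:E).

Definition weak_partial (s : seq 'I_d) (u v : Rd -> R) :=
  forall f, test_function f ->
    \int[mu]_(x in Q) (u x * partials s f x) =
    (-1) ^+ size s * \int[mu]_(x in Q) (v x * f x).

(* A Sobolev function u on Q is handled together with (representatives of) its
   weak partial derivatives: U s stands for d_{s1} ... d_{sk} u, so that
   u = U [::]. Up to null sets U is determined by u on words of length <= m,
   the only ones used for elements of H^m. *)
Definition jet := seq 'I_d -> Rd -> R.

Definition Hm (m : nat) (U : jet) :=
  forall s, (size s <= m)%N ->
    square_integrable (U s) /\ weak_partial s (U [::]) (U s).

(* H^m_0(Q) is the closure of the test functions in H^m(Q). *)
Definition Hm0 (m : nat) (U : jet) :=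
  Hm m U /\
  exists2 f : nat -> Rd -> R, (forall n, test_function (f n)) &
    forall s, (size s <= m)%N ->
      (fun n => \int[mu]_(x in Q) ((partials s (f n) x - U s x) ^+ 2))
        @ \oo --> (0 : R).

(* the jet of the Laplacian of u *)
Definition laplacian (U : jet) : jet :=
  fun s x => \sum_(i < d) U [:: i, i & s] x.

(* The pointwise product nabla^m u . nabla^m v, where nabla^m u is the scalar
   Delta^j u if m = 2j and the vector nabla Delta^j u if m = 2j + 1. *)
Definition nabla_dot (m : nat) (U V : jet) (x : Rd) : R :=
  let U' := iter m./2 laplacian U in
  let V' := iter m./2 laplacian V in
  if odd m then \sum_(i < d) U' [:: i] x * V' [:: i] x
  else U' [::] x * V' [::] x.

Definition energy (m : nat) (U V : jet) : R :=
  \int[mu]_(x in Q) nabla_dot m U V x.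

Definition L2_dot (U V : jet) : R := \int[mu]_(x in Q) (U [::] x * V [::] x).

(* lam is an eigenvalue of (-Delta)^m u = lam u in Q with Dirichlet boundary
   conditions, in the weak sense *)
Definition dirichlet_eigenvalue (m : nat) (lam : R) :=
  exists U, [/\ Hm0 m U, L2_dot U U != 0 &
    forall V, Hm0 m V -> energy m U V = lam * L2_dot U V].

(* Taking V = U in the weak equation, lam is the Rayleigh quotient of its
   eigenfunction: lam is the minimum of the Rayleigh quotient over H^m_0(Q),
   and in particular the least eigenvalue. *)
Definition first_dirichlet_eigenvalue (m : nat) (lam : R) :=
  dirichlet_eigenvalue m lam /\
  forall V, Hm0 m V -> L2_dot V V != 0 -> lam <= energy m V V / L2_dot V V.

End polyharmonic.

(* Main.v *)
Require Import Defs.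
From HB Require Import structures.
From mathcomp Require Import all_boot all_order all_algebra.
From mathcomp Require Import all_classical all_reals all_analysis.
From mathcomp Require Import ring lra zify measurable_realfun.
Import Order.TTheory GRing.Theory Num.Theory.
Import numFieldNormedType.Exports.
Local Open Scope classical_set_scope.
Local Open Scope ring_scope.

(* Lower bound.  For u smooth with compact support in (-1, 1) let J_j be the
   integral of (u^(j))^2 W^(j-m), W = 1 - x^2.  With c_j = j (2m - j + 1), the
   function R_j = W u^(j+1) + 2 (m-j) x u^(j) + c_j u^(j-1) vanishes for
   u = W^m, and integrating R_j^2 W^(j-m-1) >= 0 by parts yields inductively
   J_(j+1) >= c_(j+1) J_j, hence J_m >= (2m)! J_0 >= (2m)! |u|^2 (we take
   W = b^2 - x^2 and let b tend to 1, to avoid the singular weights).  In R^d, the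
   energy of a test function is at least the energy of its m-th derivative in
   one single direction, so lambda_1 >= (2m)!.

   Upper bound.  The cube contains the unit ball, and (-Delta)^m maps
   (1 - |x|^2)^m to the constant prod_(k <= m) 2k (2k - 2 + d), which is
   (2m/e)^(2m) up to a power of m.  We evaluate the Rayleigh quotient on the
   smooth functions rho^m exp(-eps/rho), rho = r - |x|^2, with r < 1 close to 1,
   and let eps tend to 0.

   Powers of m contribute O(log m) to the root of order 2m. *)

(** The two bounds meet because (2m)! and 4^m (m!)^2 differ by at most a power of m. The
    one-dimensional chain is sharp: for b = 1 every R_j vanishes on W^m, so each step is an equality
    there, and the only loss in one variable is W^(-m) >= 1. On the other side, (1 - |x|^2)^m is not
    a test function, and placing it in [Hm0] would require its weak derivatives and an approximating
    sequence. The factor exp(-eps/rho) yields genuine test functions, and r < 1 keeps their supports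
    inside the open cube; limits are then taken of numbers only, never in a Sobolev space. The
    energy is computed from the integral of f Delta^m f rather than of |nabla^m f|^2. Where rho > 0,
    Delta^m f tends to a constant as eps tends to 0. This convergence is not uniform near rho = 0,
    since single terms carry powers down to rho^(-m); the factor f, of size at most rho^m, keeps the
    product bounded uniformly in eps, and dominated convergence applies. *)

Set Implicit Arguments.
Unset Strict Implicit.
Unset Printing Implicit Defensive.

(** * Lebesgue measure on row vectors *)

Section measure_rV.
Variable R : realType.
Implicit Types n : nat.

Definition closed_box n (a : R) : set 'rV[R]_n :=
  [set x | forall i, x ord0 i \in `[- a, a]].

(** The sigma-algebra is generated by the coordinates, not by the topology. An open set is the
    countable union of the boxes it contains whose centre is rational and whose half-side is
    1/(k+1); such a box around a point fits into the ball of radius e as soon as 1/(k+1) < e/2. *)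
Lemma open_measurable_rV n (A : set 'rV[R]_n) : open A -> measurable A.
Proof.
move=> oA.
pose B (p : 'rV[rat]_n * nat) : set 'rV[R]_n :=
  [set x | forall i, x ord0 i \in `]ratr (p.1 ord0 i) - p.2.+1%:R^-1, ratr (p.1 ord0 i) + p.2.+1%:R^-1[].
have mB p : measurable (B p).
  rewrite (_ : B p = \bigcap_(i in [set: 'I_n])
     ((fun x : 'rV[R]_n => x ord0 i) @^-1`
        `]ratr (p.1 ord0 i) - p.2.+1%:R^-1, ratr (p.1 ord0 i) + p.2.+1%:R^-1[)); last first.
    by apply/seteqP; split => [x Bx i _|x Bx i]; [exact: Bx|exact: (Bx i I)].
  apply: fin_bigcap_measurable => // i _.
  rewrite -[X in measurable X]setTI.
  by apply: measurable_coord => //; exact: measurable_itv.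
rewrite (_ : A = \bigcup_(p in [set p | B p `<=` A]) B p).
  rewrite bigcup_mkcond; apply: countable_bigcupT_measurable => // p.
  by case: ifP.
apply/seteqP; split=> [x Ax|x [p /= BA Bx]]; last exact: BA.
have /nbhs_ballP[e /= e0 xeA] : nbhs x A by exact: open_nbhs_nbhs.
have [k ke] : exists k : nat, k.+1%:R^-1 < e / 2.
  have e20 : 0 < e / 2 by lra.
  have [k _ /(_ k)/=] := near_infty_natSinv_lt (PosNum e20).
  by rewrite leqnn => /(_ isT); exists k.
have q_ex i : exists q : rat, ratr q \in `]x ord0 i - k.+1%:R^-1, x ord0 i + k.+1%:R^-1[.
  have [|q qi] := @rat_in_itvoo R (x ord0 i - k.+1%:R^-1) (x ord0 i + k.+1%:R^-1).
    by rewrite ltrBlDr -addrA ltrDl -mulr2n pmulrn_lgt0// invr_gt0.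
  by exists q.
pose q : 'rV[rat]_n := \row_i projT1 (cid (q_ex i)).
have qE i : ratr (q ord0 i) \in `]x ord0 i - k.+1%:R^-1, x ord0 i + k.+1%:R^-1[.
  by rewrite mxE; exact: (projT2 (cid (q_ex i))).
exists (q, k) => /=; last first.
  move=> i /=; move: (qE i); rewrite !in_itv/= => /andP[h1 h2]; apply/andP.
  move: h1 h2; move: (ratr _) (k.+1%:R^-1 : R) (x ord0 i) => u v w *; split; lra.
move=> y By; apply: xeA; split => // a i; rewrite (ord1 a) /ball/=.
move: (By i) (qE i); rewrite /= !in_itv/= => /andP[h1 h2] /andP[h3 h4].
rewrite ltr_norml; apply/andP.
move: h1 h2 h3 h4 ke; move: (ratr _) (k.+1%:R^-1 : R) (x ord0 i) (y ord0 i) => u v w z *; split; lra.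
Qed.

Lemma continuous_measurable_rV n (f : 'rV[R]_n -> R) :
  continuous f -> measurable_fun setT f.
Proof.
move=> cf; apply: (measurability _ (RGenOpens.measurableE R)).
move=> /= _ [_ [a [b ->]] <-]; rewrite setTI.
by apply: open_measurable_rV; apply: open_comp => // x _; exact: cf.
Qed.

Lemma measurable_closed_box n a : measurable (@closed_box n a).
Proof.
rewrite (_ : closed_box a = \bigcap_(i in [set: 'I_n])
   ((fun x : 'rV[R]_n => x ord0 i) @^-1` `[-a, a])); last first.
  by apply/seteqP; split => [x Bx i _|x Bx i]; [exact: Bx|exact: (Bx i I)].
apply: fin_bigcap_measurable => // i _.
rewrite -[X in measurable X]setTI.
by apply: measurable_coord => //; exact: measurable_itv.
Qed.

Lemma rV_cons0 n (p : 'rV[R]_n * R) : rV_cons p ord0 ord0 = p.2.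
Proof. by rewrite mxE unlift_none. Qed.

Lemma rV_consS n (p : 'rV[R]_n * R) i : rV_cons p ord0 (lift ord0 i) = p.1 ord0 i.
Proof. by rewrite mxE liftK. Qed.

Lemma preimage_rV_cons_closed_box n a :
  @rV_cons R n @^-1` closed_box a = closed_box a `*` `[-a, a].
Proof.
apply/seteqP; split=> [[x t] B|[x t] [/= Bx Bt] i].
  split=> [i|] /=; last by have := B ord0; rewrite rV_cons0.
  by have := B (lift ord0 i); rewrite rV_consS.
by case: (unliftP ord0 i) => [j|] ->; rewrite ?rV_consS ?rV_cons0//; exact: Bx.
Qed.

Lemma lebesgue_measure_rV_closed_box n (a : R) : 0 <= a ->
  lebesgue_measure_rV R n (closed_box a) = ((2 * a) ^+ n)%:E.
Proof.
move=> a0; elim: n => [|n ih] /=.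
  by rewrite diracE expr0 mem_set// => -[].
rewrite /rV_cons_measure /pushforward preimage_rV_cons_closed_box.
rewrite product_measure1E//; last exact: measurable_closed_box.
rewrite [X in (X * _)%E]ih [X in (_ * X)%E]lebesgue_measure_itv/=.
rewrite lte_fin; case: ltP => aa.
  by rewrite -EFinB -EFinM opprK exprSr mulr_natl mulr2n.
have -> : a = 0 by lra.
by rewrite mule0 mulr0 expr0n.
Qed.

Lemma sigma_finite_lebesgue_measure_rV n :
  sigma_finite setT (lebesgue_measure_rV R n).
Proof.
exists (fun k => closed_box k%:R).
  apply/esym; rewrite -subTset => x _.
  exists (Num.bound (\sum_i `|x ord0 i|)) => // i.
  have h : `|x ord0 i| <= (Num.bound (\sum_i `|x ord0 i|))%:R.
    apply: (@le_trans _ _ (\sum_i `|x ord0 i|)).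
      by rewrite (bigD1 i)//= lerDl sumr_ge0.
    by apply/ltW/archi_boundP/sumr_ge0.
  by rewrite in_itv/= -ler_norml.
move=> k; split; first exact: measurable_closed_box.
by rewrite lebesgue_measure_rV_closed_box// ltry.
Qed.


(* the Lebesgue measure again, under a name that can carry an instance *)
Definition leb_rV n : set 'rV[R]_n -> \bar R := lebesgue_measure_rV R n.

HB.instance Definition _ n := Measure.on (@leb_rV n).
HB.instance Definition _ n := Measure_isSigmaFinite.Build _ _ _ (@leb_rV n)
  (@sigma_finite_lebesgue_measure_rV n).

Local Notation mu := (@lebesgue_measure_rV R _).
Local Open Scope ereal_scope.


Let TR : measurableType _ := measurableTypeR R.
Let leb : {sigma_finite_measure set TR -> \bar R} := @lebesgue_measure R.

Section fubini_rV.
Variables (n : nat) (f : 'rV[R]_n.+1 -> \bar R).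

Let X : measurableType _ := ('rV[R]_n * TR)%type.
Let cons : X -> 'rV[R]_n.+1 := @rV_cons R n.
Let m12 : {measure set X -> \bar R} := @leb_rV n \x leb.

Let mcons : measurable_fun setT cons.
Proof. exact: measurable_rV_cons. Qed.

Lemma tonelli_rV : measurable_fun [set: 'rV[R]_n.+1] f -> (forall x, 0 <= f x) ->
  \int[mu]_x f x = \int[mu]_x \int[@lebesgue_measure R]_t f (rV_cons (x, t)).
Proof.
move=> mf f0.
transitivity (\int[m12]_z (f \o cons) z).
  by rewrite [LHS](ge0_integral_pushforward mcons m12).
have mfc : measurable_fun [set: X] (f \o cons) := measurableT_comp mf mcons.
rewrite [LHS]fubini_tonelli1; [by []|exact: mfc|].
by move=> x; exact: f0.
Qed.

Lemma measurable_tonelli_rV : measurable_fun [set: 'rV[R]_n.+1] f ->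
  (forall x, 0 <= f x) ->
  measurable_fun [set: 'rV[R]_n] (fun x => \int[@lebesgue_measure R]_t f (rV_cons (x, t))).
Proof.
move=> mf f0.
have mfc : measurable_fun [set: X] (f \o cons) := measurableT_comp mf mcons.
apply: (@measurable_fun_fubini_tonelli_F _ _ _ _ _ leb (f \o cons) mfc).
by move=> x; exact: f0.
Qed.

Hypothesis intf : (lebesgue_measure_rV R n.+1).-integrable setT f.

Let intf_cons : m12.-integrable setT (f \o cons).
Proof.
move/integrableP : intf => [mf oo]; apply/integrableP; split.
  exact: measurableT_comp mf mcons.
move: oo; rewrite (ge0_integral_pushforward mcons m12)//.
exact: measurableT_comp.
Qed.

Let int_cons : \int[mu]_x f x = \int[m12]_z (f \o cons) z.
Proof.
rewrite [LHS](integral_pushforward mcons (mu := m12))//.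
exact: measurable_int intf.
Qed.

Lemma fubini_rV1 :
  \int[mu]_x f x = \int[mu]_x \int[@lebesgue_measure R]_t f (rV_cons (x, t)).
Proof. by rewrite int_cons -integral12_prod_meas1. Qed.

(** Both orders are needed in [integral_partial_eq0], where the differentiated coordinate has to be
    integrated in the inner integral. *)
Lemma fubini_rV2 :
  \int[mu]_x f x = \int[@lebesgue_measure R]_t \int[mu]_x f (rV_cons (x, t)).
Proof. by rewrite int_cons -integral21_prod_meas1. Qed.

End fubini_rV.
Local Close Scope ereal_scope.
End measure_rV.

(** * Directional derivatives *)

Section directional_derivatives.
Variables (R : realType) (V : normedModType R).
Implicit Types (f : V -> R) (x u v : V).

Lemma is_derive_line f x v (t : R) : derivable f (x + t *: v) v ->
  is_derive t (1 : R) (fun s : R => f (x + s *: v)) ('D_v f (x + t *: v)).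
Proof.
move=> df.
have E : (fun h : R => h^-1 *: (((fun s : R => f (x + s *: v)) \o shift t) (h *: (1 : R)) - f (x + t *: v))) =
   (fun h : R => h^-1 *: ((f \o shift (x + t *: v)) (h *: v) - f (x + t *: v))).
  apply/funext => h /=; congr (_ *: (f _ - _)).
  by rewrite [h *: 1]mulr1 scalerDl addrCA addrC.
by split; rewrite /derivable /derive E.
Qed.

Lemma mean_value_line f x v (h : R) : 0 < h -> (forall y, derivable f y v) ->
  exists2 t : R, 0 < t < h & f (x + h *: v) - f x = h * 'D_v f (x + t *: v).
Proof.
move=> h0 df.
have [||t] := @MVT R (fun s : R => f (x + s *: v)) (fun s => 'D_v f (x + s *: v)) 0 h h0.
- by move=> t _; exact: is_derive_line.
- apply: continuous_subspaceT => t; apply: differentiable_continuous.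
  by apply/derivable1_diffP; case: (is_derive_line (df (x + t *: v))).
by rewrite in_itv/= scale0r addr0 subr0 => t0 ->; exists t => //; rewrite mulrC.
Qed.

(** Schwarz's theorem. Two applications of the mean value theorem turn the second difference of f
    over the parallelogram with sides h u, h v into h^2 times a mixed derivative at an intermediate
    point. The second difference is symmetric in u and v, so both mixed derivatives agree at points
    close to x, and continuity at x concludes. *)
Lemma derive_comm f x u v : (forall y, derivable f y u) ->
  (forall y, derivable f y v) ->
  (forall y, derivable ('D_u f) y v) -> (forall y, derivable ('D_v f) y u) ->
  {for x, continuous ('D_v ('D_u f))} -> {for x, continuous ('D_u ('D_v f))} ->
  'D_v ('D_u f) x = 'D_u ('D_v f) x.
Proof.
move=> fu fv fuv fvu cuv cvu.
have main u' v' : (forall y, derivable f y u') ->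
    (forall y, derivable ('D_u' f) y v') -> forall h, 0 < h ->
    exists s t, [/\ 0 < s < h, 0 < t < h &
    f (x + h *: u' + h *: v') - f (x + h *: u') - (f (x + h *: v') - f x) =
      h * h * 'D_v' ('D_u' f) (x + s *: u' + t *: v')].
  move=> fu' fu'v' h h0.
  pose g y := f (y + h *: v') - f y.
  have shiftE : (fun y => f (y + h *: v')) = f \o shift (h *: v') by [].
  have dsh y : is_derive y u' (f \o shift (h *: v')) ('D_u' f (y + h *: v')).
    have E : (fun k : R => k^-1 *: (((f \o shift (h *: v')) \o shift y) (k *: u') -
          (f \o shift (h *: v')) y)) =
        (fun k : R => k^-1 *: ((f \o shift (y + h *: v')) (k *: u') - f (y + h *: v'))).
      by apply/funext => k /=; rewrite addrA.
    split; rewrite /derivable /derive E//; exact: fu'.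
  have dg y : is_derive y u' g ('D_u' f (y + h *: v') - 'D_u' f y).
    by apply: is_deriveB; apply: derivableP; exact: fu'.
  have [|s sh Es] := @mean_value_line g x u' h h0.
    by move=> y; case: (dg y).
  have [|t th Et] := @mean_value_line ('D_u' f) (x + s *: u') v' h h0.
    by [].
  exists s, t; split => //; rewrite -mulrA -Et.
  have -> : 'D_u' f (x + s *: u' + h *: v') - 'D_u' f (x + s *: u') = 'D_u' g (x + s *: u').
    by case: (dg (x + s *: u')).
  by rewrite -Es.
apply/eqP; rewrite -subr_eq0 -normr_le0; apply/ler_addgt0Pr => e e0; rewrite add0r.
have e20 : 0 < e / 2 by lra.
have := cuv (ball ('D_v ('D_u f) x) (e / 2)) (nbhsx_ballx _ _ e20).
have := cvu (ball ('D_u ('D_v f) x) (e / 2)) (nbhsx_ballx _ _ e20).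
move=> /nbhs_ballP[d1 /= d10 h1] /nbhs_ballP[d2 /= d20 h2].
(* The summand 1 keeps N positive when u = v = 0; h N is then the smaller of the two radii, so both
   intermediate points lie in both balls. *)
pose N := `|u| + `|v| + 1.
have N0 : 0 < N by rewrite /N; have := normr_ge0 u; have := normr_ge0 v; lra.
pose h := Num.min d1 d2 / N.
have h0 : 0 < h by rewrite divr_gt0// lt_min d10.
have close s t : 0 < s < h -> 0 < t < h ->
    `|s *: u + t *: v| < Num.min d1 d2.
  move=> /andP[s0 sh] /andP[t0 th].
  rewrite (le_lt_trans (ler_normD _ _))// !normrZ !gtr0_norm//.
  have : h * N = Num.min d1 d2 by rewrite /h divfK// gt_eqF.
  rewrite /N; have := ler_wpM2r (normr_ge0 u) (ltW sh).
  have := ler_wpM2r (normr_ge0 v) (ltW th); nra.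
have [s [t [sh th E1]]] := main u v fu fuv h h0.
have [s' [t' [sh' th' E2]]] := main v u fv fvu h h0.
have E : 'D_v ('D_u f) (x + s *: u + t *: v) = 'D_u ('D_v f) (x + s' *: v + t' *: u).
  have hh : h * h != 0 by rewrite mulf_neq0// gt_eqF.
  apply: (mulfI hh (etrans (esym E1) (etrans _ E2))).
  rewrite [x + h *: v + h *: u]addrAC.
  move: (f (x + h *: u + h *: v)) (f (x + h *: u)) (f (x + h *: v)) (f x) => p q p' q'.
  by ring.
have near_x s0 t0 w1 w2 d : `|s0 *: w1 + t0 *: w2| < d ->
    ball x d (x + s0 *: w1 + t0 *: w2).
  by rewrite -ball_normE /= -addrA opprD addrA subrr add0r normrN.
have H2 : ball ('D_v ('D_u f) x) (e / 2) ('D_v ('D_u f) (x + s *: u + t *: v)).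
  by apply/h2/near_x; have := close _ _ sh th; rewrite lt_min => /andP[].
have H1 : ball ('D_u ('D_v f) x) (e / 2) ('D_u ('D_v f) (x + s' *: v + t' *: u)).
  apply/h1/near_x; have := close _ _ th' sh'.
  by rewrite addrC lt_min => /andP[].
move: H2 H1; rewrite -!ball_normE /= => H2 H1.
apply: (le_trans (ler_distD ('D_v ('D_u f) (x + s *: u + t *: v)) _ _)).
rewrite [leRHS]splitr; apply: lerD; first exact: ltW H2.
by rewrite distrC E; exact: ltW H1.
Qed.

End directional_derivatives.

(** * Smooth functions and test functions *)

Section smooth_functions.
Variables (R : realType) (d : nat).
Local Notation Rd := 'rV[R]_d.
Implicit Types (f g : Rd -> R) (s t : seq 'I_d) (G : set (Rd -> R)).

Local Notation e_ i := (delta_mx ord0 i : Rd).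

Lemma partials_cat s t f : partials (s ++ t) f = partials s (partials t f).
Proof. exact: foldr_cat. Qed.

Lemma smooth_continuous f : smooth f -> continuous f.
Proof. by move=> /(_ [::])[]. Qed.

Lemma smooth_derivable f : smooth f -> forall x i, derivable f x (e_ i).
Proof. by move=> /(_ [::])[_ h] x i; exact: h. Qed.

Lemma smooth_partials s f : smooth f -> smooth (partials s f).
Proof. by move=> sf t; rewrite -partials_cat; exact: sf. Qed.

(** Closure of G under sums and products. If the first partials of the generators stay in this
    closure, then so do all iterated partials, and smoothness reduces to a first-order check on
    generators; no Leibniz formula of higher order is required. *)
Inductive generated G : (Rd -> R) -> Prop :=
| generated_base f : G f -> generated G f
| generated_add f g : generated G f -> generated G g -> generated G (f \+ g)
| generated_mul f g : generated G f -> generated G g -> generated G (f \* g).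

Lemma generated_smooth G :
  (forall f, G f -> continuous f /\
     forall i, (forall x, derivable f x (e_ i)) /\ generated G (partials [:: i] f)) ->
  forall f, generated G f -> smooth f.
Proof.
move=> HG.
have step f : generated G f -> continuous f /\
    forall i, (forall x, derivable f x (e_ i)) /\ generated G (partials [:: i] f).
  elim=> {f} [f /HG//|f g sf [cf df] sg [cg dg]|f g sf [cf df] sg [cg dg]].
    split=> [x|i]; first by apply: continuousD; [exact: cf|exact: cg].
    have [{}df sf'] := df i; have [{}dg sg'] := dg i.
    split=> [x|]; first exact: derivableD.
    rewrite (_ : partials _ _ = partials [:: i] f \+ partials [:: i] g).
      exact: generated_add.
    by apply/funext => x; rewrite /= deriveD.
  split=> [x|i]; first by apply: continuousM; [exact: cf|exact: cg].
  have [{}df sf'] := df i; have [{}dg sg'] := dg i.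
  split=> [x|]; first exact: derivableM.
  rewrite (_ : partials _ _ = (f \* partials [:: i] g) \+ (g \* partials [:: i] f)).
    by apply: generated_add; apply: generated_mul.
  by apply/funext => x; rewrite /= deriveM.
move=> f gf s.
suff : generated G (partials s f).
  by move=> /step[cf df]; split=> // i x; have [] := df i.
by elim: s => //= i s /step[_ /(_ i)[]].
Qed.

Lemma generated_smoothE f : generated (@smooth R d) f -> smooth f.
Proof.
apply: generated_smooth => {}f sf; split; first exact: smooth_continuous.
move=> i; split=> [x|]; first exact: smooth_derivable.
by apply: generated_base; exact: smooth_partials.
Qed.

Lemma smoothD f g : smooth f -> smooth g -> smooth (f \+ g).
Proof.
by move=> sf sg; apply/generated_smoothE/generated_add; exact: generated_base.
Qed.

Lemma smoothM f g : smooth f -> smooth g -> smooth (f \* g).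
Proof.
by move=> sf sg; apply/generated_smoothE/generated_mul; exact: generated_base.
Qed.

Lemma smooth_cst (c : R) : smooth (fun _ : Rd => c).
Proof.
suff E s : partials s (fun _ : Rd => c) = if s is [::] then (fun=> c) else (fun=> 0).
  move=> s; rewrite E; case: s => [|i s]; split=> *;
    by [exact: cst_continuous|exact: derivable_cst].
elim: s => //= i s ->; apply/funext => x; case: s => [|j s]; exact: derive_cst.
Qed.

Lemma smoothZ (c : R) f : smooth f -> smooth (fun x => c * f x).
Proof. by move=> sf; apply: (smoothM (smooth_cst c)). Qed.

Lemma smooth_sum (I : Type) (r : seq I) (P : pred I) (F : I -> Rd -> R) :
  (forall i, smooth (F i)) -> smooth (fun x => \sum_(i <- r | P i) F i x).
Proof.
move=> sF; elim: r => [|i r ih].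
  by rewrite (_ : (fun _ => _) = (fun=> 0)); [exact: smooth_cst|apply/funext => x; rewrite big_nil].
have [Pi|Pi] := boolP (P i).
  rewrite (_ : (fun _ => _) = (F i \+ (fun x => \sum_(i <- r | P i) F i x))).
    exact: (smoothD (sF i) ih).
  by apply/funext => x; rewrite big_cons Pi.
by rewrite (_ : (fun _ => _) = (fun x => \sum_(i <- r | P i) F i x))//;
  apply/funext => x; rewrite big_cons (negbTE Pi).
Qed.

Lemma partial_sum (I : finType) (F : I -> Rd -> R) i :
  (forall j, smooth (F j)) ->
  partials [:: i] (fun x => \sum_j F j x) = (fun x => \sum_j partials [:: i] (F j) x).
Proof.
move=> sF; apply/funext => x /=.
suff : forall r : seq I, 'D_(e_ i) (fun y => \sum_(j <- r) F j y) x =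
    \sum_(j <- r) 'D_(e_ i) (F j) x by apply.
elim=> [|j r ih].
  rewrite big_nil (_ : (fun _ => _) = cst 0) ?derive_cst//.
  by apply/funext => y; rewrite big_nil.
rewrite (_ : (fun _ => _) = F j + (fun y => \sum_(k <- r) F k y)).
  rewrite big_cons -ih deriveD//; first exact: smooth_derivable.
  exact/smooth_derivable/smooth_sum.
by apply/funext => y; rewrite big_cons.
Qed.

Lemma partialM f g i : smooth f -> smooth g ->
  partials [:: i] (f \* g) = (f \* partials [:: i] g) \+ (partials [:: i] f \* g).
Proof.
move=> sf sg; apply/funext => x; rewrite /= deriveM; [|exact: smooth_derivable..].
by congr (_ + _); exact: mulrC.
Qed.

Lemma partialC i j f : smooth f -> partials [:: i; j] f = partials [:: j; i] f.
Proof.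
move=> sf.
have sp s x k : derivable (partials s f) x (delta_mx ord0 k).
  exact/smooth_derivable/smooth_partials.
have cp s x : {for x, continuous (partials s f)}.
  exact: (smooth_continuous (smooth_partials s sf)).
apply/funext => x; apply: derive_comm => [y|y|y|y||].
- exact: (sp [::]).
- exact: (sp [::]).
- exact: (sp [:: j]).
- exact: (sp [:: i]).
- exact: (cp [:: i; j]).
- exact: (cp [:: j; i]).
Qed.

Definition lap f : Rd -> R := fun x => \sum_i partials [:: i; i] f x.

Lemma smooth_lap f : smooth f -> smooth (lap f).
Proof. by move=> sf; apply: smooth_sum => i; exact: (smooth_partials [:: i; i] sf). Qed.

Lemma partial_lap i f : smooth f -> partials [:: i] (lap f) = lap (partials [:: i] f).
Proof.
move=> sf; rewrite partial_sum; last by move=> j; exact: (smooth_partials [:: j; j] sf).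
apply/funext => x; apply: eq_bigr => j _.
exact: (congr1 (@^~ x) (etrans (partialC i j (smooth_partials [:: j] sf))
  (congr1 (partials [:: j]) (partialC i j sf)))).
Qed.

Lemma partials_lap s f : smooth f -> partials s (lap f) = lap (partials s f).
Proof.
move=> sf; elim: s => [//|i s ih].
exact: (etrans (congr1 (partials [:: i]) ih) (partial_lap i (smooth_partials s sf))).
Qed.

End smooth_functions.

Section test_functions.
Variables (R : realType) (d : nat).
Local Notation Rd := 'rV[R]_d.
Local Notation Q := (@hypercube R d).
Implicit Types (f g : Rd -> R) (s t : seq 'I_d).

(** The complement of K is open and f vanishes on it, so the same K serves for every derivative. *)
Lemma test_function_partials s f : test_function f -> test_function (partials s f).
Proof.
move=> [sf [K [cK KQ Kf]]]; split; first exact: smooth_partials.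
exists K; split => //; elim: s => //= i s ih x Kx.
rewrite (@near_eq_derive _ _ _ _ (cst 0)) ?derive_cst//.
have oK : open (~` K).
  by apply: closed_openC; apply: compact_closed => //; exact: norm_hausdorff.
by apply: filterS (open_nbhs_nbhs (conj oK Kx)) => y Ky; exact: ih.
Qed.

Lemma test_functionD f g : test_function f -> test_function g -> test_function (f \+ g).
Proof.
move=> [sf [K [cK KQ Kf]]] [sg [L [cL LQ Lg]]]; split; first exact: smoothD.
exists (K `|` L); split; first exact: compactU.
  by rewrite subUset.
by move=> x /not_orP[Kx Lx] /=; rewrite Kf// Lg// addr0.
Qed.

Lemma test_functionMr f g : test_function f -> smooth g -> test_function (f \* g).
Proof.
move=> [sf [K [cK KQ Kf]]] sg; split; first exact: smoothM.
by exists K; split => // x Kx /=; rewrite Kf// mul0r.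
Qed.

Lemma test_function_sum (I : Type) (r : seq I) (P : pred I) (F : I -> Rd -> R) :
  (forall i, test_function (F i)) -> test_function (fun x => \sum_(i <- r | P i) F i x).
Proof.
move=> sF; elim: r => [|i r ih].
  rewrite (_ : (fun _ => _) = (fun=> 0)); last by apply/funext => x; rewrite big_nil.
  split; first exact: smooth_cst.
  by exists set0; split => //; exact: compact0.
have [Pi|Pi] := boolP (P i).
  rewrite (_ : (fun _ => _) = (F i \+ (fun x => \sum_(i <- r | P i) F i x))).
    exact: (test_functionD (sF i) ih).
  by apply/funext => x; rewrite big_cons Pi.
by rewrite (_ : (fun _ => _) = (fun x => \sum_(i <- r | P i) F i x))//;
  apply/funext => x; rewrite big_cons (negbTE Pi).
Qed.

Lemma test_function_lap f : test_function f -> test_function (lap f).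
Proof. by move=> tf; apply: test_function_sum => i; exact: (test_function_partials [:: i; i] tf). Qed.

Lemma test_function_out f x : test_function f -> ~ Q x -> f x = 0.
Proof. by move=> [_ [K [_ KQ Kf]]] Qx; apply: Kf => /KQ. Qed.

Lemma test_function_bounded f : test_function f -> exists2 M : R, 0 < M & forall x, `|f x| <= M.
Proof.
move=> [sf [K [cK KQ Kf]]].
have [[x0 Kx0]|K0] := pselect (K !=set0); last first.
  by exists 1 => // x; rewrite Kf ?normr0// => Kx; apply: K0; exists x.
have cf : {within K, continuous (fun x => `|f x|)}.
  apply: continuous_subspaceT => x; apply: continuous_comp.
    exact: smooth_continuous.
  exact: norm_continuous.
have [c Kc fc] : exists2 c, c \in K & forall t : Rd, t \in K -> `|f t| <= `|f c|.
  by apply: EVT_max_rV => //; exists x0.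
exists (`|f c| + 1); first by rewrite ltr_wpDl.
move=> x; have [Kx|Kx] := pselect (K x).
  by rewrite (le_trans (fc x _)) ?inE// lerDl.
by rewrite Kf// normr0 addr_ge0.
Qed.

Lemma hypercube_closed_box : Q `<=` closed_box 1.
Proof. by move=> x Qx i; have /andP[h1 h2] := Qx i; rewrite in_itv/= !ltW. Qed.

Lemma measurable_hypercube : measurable Q.
Proof.
rewrite (_ : Q = \bigcap_(i in [set: 'I_d]) ((fun x : Rd => x ord0 i) @^-1` `]-1, 1[)).
  apply: fin_bigcap_measurable => // i _.
  rewrite -[X in measurable X]setTI.
  by apply: measurable_coord => //; exact: measurable_itv.
apply/seteqP; split => [x Qx i _|x Qx i]; first by rewrite /= in_itv; exact: Qx.
by have := Qx i I; rewrite /= in_itv.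
Qed.

End test_functions.

(** * Integration by parts *)

Section integration_by_parts.
Variable R : realType.
Implicit Types n : nat.
Local Notation mu := (@lebesgue_measure_rV R _).
Local Notation leb := (@lebesgue_measure R).

Lemma integral_derive (F f : R -> R) (a b : R) : a < b ->
  {within `[a, b], continuous f} ->
  (forall x, x \in `[a, b] -> is_derive x (1 : R) F (f x)) ->
  (\int[leb]_(x in `[a, b]) (f x)%:E = (F b - F a)%:E)%E.
Proof.
move=> ab cf dF.
have cF x : x \in `[a, b] -> {for x, continuous F}.
  move=> xab; apply: differentiable_continuous; apply/derivable1_diffP.
  by case: (dF x xab).
rewrite (@continuous_FTC2 _ _ F)//.
- split=> [x xab||].
  + by have [] := dF x (subset_itv_oo_cc xab).
  + by apply: cvg_at_right_filter; apply: cF; rewrite in_itv/= lexx ltW.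
  + by apply: cvg_at_left_filter; apply: cF; rewrite in_itv/= lexx ltW.
- by move=> x xab; rewrite derive1E; case: (dF x (subset_itv_oo_cc xab)).
Qed.

Lemma rV_cons_line n (x v : 'rV[R]_n) (s t h : R) :
  rV_cons (h *: v + x, h * s + t) = h *: rV_cons (v, s) + rV_cons (x, t).
Proof.
apply/rowP => i; case: (unliftP ord0 i) => [j|] ->.
  by rewrite !mxE liftK /= !mxE.
by rewrite !mxE unlift_none.
Qed.

Lemma rV_cons_delta0 n : rV_cons (0 : 'rV[R]_n, 1 : R) = delta_mx ord0 ord0.
Proof.
apply/rowP => i; case: (unliftP ord0 i) => [j|] ->.
  by rewrite !mxE liftK /= !mxE.
by rewrite !mxE unlift_none.
Qed.

Lemma rV_cons_deltaS n (j : 'I_n) :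
  rV_cons (delta_mx ord0 j : 'rV[R]_n, 0 : R) = delta_mx ord0 (lift ord0 j).
Proof.
apply/rowP => i; case: (unliftP ord0 i) => [k|] ->.
  by rewrite !mxE liftK /= !mxE (inj_eq lift_inj).
by rewrite !mxE unlift_none.
Qed.

Lemma ball_rV_cons n (x y : 'rV[R]_n) (t s e : R) : 0 < e ->
  ball x e y -> ball t e s -> ball (rV_cons (x, t)) e (rV_cons (y, s)).
Proof.
move=> e0 [_ xy] ts; split => // i j; rewrite (ord1 i).
by case: (unliftP ord0 j) => [k|] ->; rewrite ?rV_consS ?rV_cons0//; exact: xy.
Qed.

Lemma rV_cons_continuousl n t : continuous (fun x : 'rV[R]_n => rV_cons (x, t)).
Proof.
move=> x A /nbhs_ballP[e /= e0 eA]; apply/nbhs_ballP; exists e => // y xy.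
by apply: eA; apply: ball_rV_cons => //; exact: ballxx.
Qed.

Lemma rV_cons_continuousr n x : continuous (fun t : R => rV_cons (x : 'rV[R]_n, t)).
Proof.
move=> t A /nbhs_ballP[e /= e0 eA]; apply/nbhs_ballP; exists e => // s ts.
by apply: eA; apply: ball_rV_cons => //; exact: ballxx.
Qed.

Lemma is_derive_rV_cons0 n (g : 'rV[R]_n.+1 -> R) x t :
  derivable g (rV_cons (x, t)) (delta_mx ord0 ord0) ->
  is_derive t (1 : R) (fun s : R => g (rV_cons (x, s)))
    (partials [:: ord0] g (rV_cons (x, t))).
Proof.
move=> dg.
have E : (fun h : R => h^-1 *: (((fun s : R => g (rV_cons (x, s))) \o shift t) (h *: (1 : R)) -
      g (rV_cons (x, t)))) =
    (fun h : R => h^-1 *: ((g \o shift (rV_cons (x, t))) (h *: delta_mx ord0 ord0) -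
      g (rV_cons (x, t)))).
  apply/funext => h /=; congr (_ *: (g _ - _)).
  by rewrite -rV_cons_delta0 -rV_cons_line scaler0 add0r.
by split; rewrite /derivable /= /derive E.
Qed.

Lemma is_derive_rV_consS n (g : 'rV[R]_n.+1 -> R) x t j :
  derivable g (rV_cons (x, t)) (delta_mx ord0 (lift ord0 j)) ->
  is_derive x (delta_mx ord0 j) (fun y => g (rV_cons (y, t)))
    (partials [:: lift ord0 j] g (rV_cons (x, t))).
Proof.
move=> dg.
have E : (fun h : R => h^-1 *: (((fun y => g (rV_cons (y, t))) \o shift x) (h *: delta_mx ord0 j) -
      g (rV_cons (x, t)))) =
    (fun h : R => h^-1 *: ((g \o shift (rV_cons (x, t))) (h *: delta_mx ord0 (lift ord0 j)) -
      g (rV_cons (x, t)))).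
  apply/funext => h /=; congr (_ *: (g _ - _)).
  by rewrite -rV_cons_deltaS -rV_cons_line mulr0 add0r.
by split; rewrite /derivable /= /derive E.
Qed.

Lemma hypercube_rV_cons n (x : 'rV[R]_n) t :
  hypercube (rV_cons (x, t)) <-> hypercube x /\ -1 < t < 1.
Proof.
split=> [Q|[Qx Qt] i].
  split=> [i|]; first by have := Q (lift ord0 i); rewrite rV_consS.
  by have := Q ord0; rewrite rV_cons0.
by case: (unliftP ord0 i) => [j|] ->; rewrite ?rV_consS ?rV_cons0//; exact: Qx.
Qed.

Lemma hypercube_finite n : (mu (@hypercube R n) < +oo)%E.
Proof.
apply: (@le_lt_trans _ _ (mu (@closed_box R n 1))).
  apply: le_measure; rewrite ?inE.
  - exact: measurable_hypercube.
  - exact: measurable_closed_box.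
  - exact: hypercube_closed_box.
by rewrite lebesgue_measure_rV_closed_box// ltry.
Qed.

Lemma bounded_integrable_hypercube n (f : 'rV[R]_n -> R) (M : R) :
  measurable_fun (@hypercube R n) f ->
  (forall x, hypercube x -> `|f x| <= M) -> mu.-integrable (@hypercube R n) (EFin \o f).
Proof.
move=> mf fM; apply: measurable_bounded_integrable => //.
- exact: measurable_hypercube.
- exact: hypercube_finite.
- by exists M; split; [exact: num_real|move=> N MN x Qx /=; rewrite (le_trans (fM x Qx))// ltW].
Qed.

Lemma restrict_hypercube n (f : 'rV[R]_n -> R) :
  (forall x, ~ hypercube x -> f x = 0) -> (EFin \o f) \_ (@hypercube R n) = EFin \o f.
Proof.
move=> f0; apply/funext => x; rewrite patchE; case: ifPn => // /negP.
by rewrite inE => /f0 /= ->.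
Qed.

Lemma integral_hypercubeT n (f : 'rV[R]_n -> R) :
  (forall x, ~ hypercube x -> f x = 0) ->
  (\int[mu]_(x in @hypercube R n) (f x)%:E = \int[mu]_x (f x)%:E)%E.
Proof. by move=> f0; rewrite integral_mkcond restrict_hypercube. Qed.

Lemma integral_itvT (f : R -> R) : (forall t, ~ -1 < t < 1 -> f t = 0) ->
  (\int[leb]_t (f t)%:E = \int[leb]_(t in `[(-1)%R, 1%R]) (f t)%:E)%E.
Proof.
move=> f0; rewrite [RHS]integral_mkcond; apply: eq_integral => t _.
rewrite patchE; case: ifPn => // /negP; rewrite inE /= in_itv /= => h.
by rewrite f0// => /andP[h1 h2]; apply: h; rewrite !ltW.
Qed.

(** Induction on the dimension. The hypotheses speak of the single derivative in direction i, so
    that the slices of g inherit them directly; in the direction [ord0] the inner integral is a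
    difference of boundary values, which are 0. *)
Lemma integral_partial_eq0 n (g : 'rV[R]_n -> R) (i : 'I_n) (M : R) :
  continuous (partials [:: i] g) ->
  (forall x, derivable g x (delta_mx ord0 i)) ->
  (forall x, ~ hypercube x -> g x = 0 /\ partials [:: i] g x = 0) ->
  (forall x, `|partials [:: i] g x| <= M) ->
  (\int[mu]_x (partials [:: i] g x)%:E = 0)%E.
Proof.
elim: n => [|n ih] in g i *; first by case: i.
move=> cdg dg g0 gM.
have int_dg : mu.-integrable [set: 'rV[R]_n.+1] (EFin \o partials [:: i] g).
  rewrite -restrict_hypercube; last by move=> x /g0[].
  apply/(integrable_mkcond _ (@measurable_hypercube R n.+1)).
  apply: (@bounded_integrable_hypercube _ _ M); last by move=> x _; exact: gM.
  by apply: measurable_funTS; exact: continuous_measurable_rV.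
case: (unliftP ord0 i) => [j|] ij; subst i.
  rewrite fubini_rV2// integral0_eq// => t _ /=.
  rewrite (_ : (fun x => _) = (EFin \o partials [:: j] (fun y => g (rV_cons (y, t))))); last first.
    apply/funext => x /=.
    by have [_ ->] := is_derive_rV_consS (dg (rV_cons (x, t))).
  have dE x : partials [:: j] (fun y => g (rV_cons (y, t))) x =
      partials [:: lift ord0 j] g (rV_cons (x, t)).
    by rewrite /=; have [_ ->] := is_derive_rV_consS (dg (rV_cons (x, t))).
  apply: ih.
  - rewrite (_ : partials _ _ = fun x => partials [:: lift ord0 j] g (rV_cons (x, t))).
      move=> x; apply: (@continuous_comp _ _ _ (fun x => rV_cons (x, t))); last exact: cdg.
      exact: rV_cons_continuousl.
    by apply/funext => x; exact: dE.
  - by move=> x; have [] := is_derive_rV_consS (dg (rV_cons (x, t))).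
  - move=> x Qx; rewrite dE; apply: g0 => /hypercube_rV_cons[//].
  - by move=> x; rewrite dE; exact: gM.
rewrite fubini_rV1// integral0_eq// => x _ /=.
have g0x t : ~ -1 < t < 1 -> g (rV_cons (x, t)) = 0 /\ partials [:: ord0] g (rV_cons (x, t)) = 0.
  by move=> t1; apply: g0 => /hypercube_rV_cons[].
have ltN11 : (-1 : R) < 1 by lra.
rewrite (@integral_itvT (fun t => partials [:: ord0] g (rV_cons (x, t)))); last first.
  by move=> t /g0x[].
have cdgx : continuous (fun t => partials [:: ord0] g (rV_cons (x, t))).
  move=> t; apply: (@continuous_comp _ _ _ (fun t => rV_cons (x, t))); last exact: cdg.
  exact: rV_cons_continuousr.
rewrite (integral_derive ltN11 (continuous_subspaceT cdgx) (fun t _ => is_derive_rV_cons0 (dg (rV_cons (x, t))))).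
by rewrite (g0x 1 _).1 ?(g0x (-1) _).1 ?subrr// ltxx ?andbF.
Qed.

End integration_by_parts.

Section test_function_integrals.
Variables (R : realType) (d : nat).
Local Notation Rd := 'rV[R]_d.
Local Notation mu := (@lebesgue_measure_rV R d).
Local Notation Q := (@hypercube R d).
Implicit Types (f g : Rd -> R) (s t : seq 'I_d).

Lemma test_function_integrable f : test_function f -> mu.-integrable Q (EFin \o f).
Proof.
move=> tf; have [M _ fM] := test_function_bounded tf.
apply: (bounded_integrable_hypercube (M := M)); last by move=> x _; exact: fM.
apply: measurable_funTS; apply: continuous_measurable_rV.
by apply: smooth_continuous; case: tf.
Qed.

Lemma integral_partial_test f i : test_function f -> \int[mu]_(x in Q) partials [:: i] f x = 0.
Proof.
move=> tf; have tdf := test_function_partials [:: i] tf.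
have [M _ fM] := test_function_bounded tdf.
rewrite /Rintegral integral_hypercubeT; last first.
  by move=> x; exact: test_function_out.
rewrite (@integral_partial_eq0 _ _ _ _ M)//.
- by case: tdf => /smooth_continuous.
- by case: tf => /smooth_derivable.
- by move=> x Qx; split; exact: test_function_out Qx.
Qed.

Lemma integral_partialMr f g i : test_function f -> smooth g ->
  \int[mu]_(x in Q) (f x * partials [:: i] g x) =
  - \int[mu]_(x in Q) (partials [:: i] f x * g x).
Proof.
move=> tf sg; have [sf _] := tf.
have := integral_partial_test i (test_functionMr tf sg).
rewrite partialM//= RintegralD; first last.
- apply: test_function_integrable; apply: (test_functionMr _ sg).
  exact: (test_function_partials [:: i] tf).
- apply: test_function_integrable; apply: (test_functionMr tf).
  exact: (smooth_partials [:: i] sg).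
- exact: measurable_hypercube.
by move/eqP; rewrite addr_eq0 => /eqP.
Qed.

End test_function_integrals.

(** * Energy of a test function *)

Section test_jets.
Variables (R : realType) (d : nat).
Local Notation Rd := 'rV[R]_d.
Local Notation mu := (@lebesgue_measure_rV R d).
Local Notation Q := (@hypercube R d).
Implicit Types (f g : Rd -> R) (s t : seq 'I_d).

Definition test_jet f : jet R d := fun s => partials s f.

Lemma partials_rcons s i f : smooth f ->
  partials s (partials [:: i] f) = partials [:: i] (partials s f).
Proof.
move=> sf; elim: s => [//|j s ih].
exact: (etrans (congr1 (partials [:: j]) ih) (partialC j i (smooth_partials s sf))).
Qed.

Lemma weak_partial_test s f : smooth f -> weak_partial s f (partials s f).
Proof.
move=> + g tg; elim: s f => [|i s ih] f sf.
  by rewrite /= expr0 mul1r.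
have tsg := test_function_partials s tg.
have [sg _] := tg.
have ibp := integral_partialMr i tsg sf.
transitivity (- \int[mu]_(x in Q) (partials s g x * partials [:: i] f x)).
  rewrite ibp opprK; apply: eq_Rintegral => x _; exact: mulrC.
under eq_Rintegral do rewrite mulrC.
by rewrite (ih _ (smooth_partials [:: i] sf)) partials_rcons//= exprS mulN1r mulNr.
Qed.

Lemma square_integrable_test f : test_function f -> square_integrable f.
Proof.
move=> tf; have [sf _] := tf; split.
  apply: measurable_funTS; apply: continuous_measurable_rV.
  exact: smooth_continuous.
rewrite (_ : (fun x => _) = EFin \o (f \* f)); last first.
  by apply/funext => x; rewrite /= expr2.
by apply: test_function_integrable; exact: test_functionMr.
Qed.

Lemma Hm0_test m f : test_function f -> Hm0 m (test_jet f).
Proof.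
move=> tf; have [sf _] := tf; split.
  move=> s _; split; first exact/square_integrable_test/test_function_partials.
  exact: weak_partial_test.
exists (fun=> f) => // s _.
rewrite (_ : (fun n => _) = fun=> 0); first exact: cvg_cst.
apply/funext => n; rewrite /Rintegral integral0_eq// => x _.
by rewrite /test_jet subrr expr0n.
Qed.

Lemma smooth_iter_lap j f : smooth f -> smooth (iter j (@lap R d) f).
Proof. by move=> sf; elim: j => [|j ih]; [exact: sf|exact: (smooth_lap ih)]. Qed.

Lemma iter_laplacian_test j f : smooth f ->
  iter j (@laplacian R d) (test_jet f) = test_jet (iter j (@lap R d) f).
Proof.
move=> sf; elim: j => // j ih; rewrite !iterS ih.
have slf := smooth_iter_lap j sf.
by apply/funext => s; rewrite /test_jet (partials_lap _ slf).
Qed.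

Lemma test_function_iter_lap j f : test_function f -> test_function (iter j (@lap R d) f).
Proof. by move=> tf; elim: j => [|j ih]; [exact: tf|exact: (test_function_lap ih)]. Qed.

Lemma integral_sum_test (I : finType) (F : I -> Rd -> R) :
  (forall i, test_function (F i)) ->
  \int[mu]_(x in Q) (\sum_i F i x) = \sum_i \int[mu]_(x in Q) F i x.
Proof.
move=> tF; suff : forall r : seq I, \int[mu]_(x in Q) (\sum_(i <- r) F i x) =
    \sum_(i <- r) \int[mu]_(x in Q) F i x by apply.
elim=> [|i r ih].
  by rewrite big_nil /Rintegral integral0_eq// => x _; rewrite big_nil.
rewrite big_cons -ih -RintegralD.
- by apply: eq_Rintegral => x _; rewrite big_cons.
- exact: measurable_hypercube.
- exact: test_function_integrable.
- by apply: test_function_integrable; exact: test_function_sum.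
Qed.

Lemma integral_lap f g : test_function f -> test_function g ->
  \int[mu]_(x in Q) (f x * lap g x) =
  - \sum_i \int[mu]_(x in Q) (partials [:: i] f x * partials [:: i] g x).
Proof.
move=> tf tg; have [sg _] := tg.
under eq_Rintegral do rewrite mulr_sumr.
rewrite (integral_sum_test (F := fun i => f \* partials [:: i; i] g)); last first.
  by move=> i; apply: (test_functionMr tf); exact: (smooth_partials [:: i; i] sg).
rewrite -sumrN; apply: eq_bigr => i _.
exact: (integral_partialMr i tf (smooth_partials [:: i] sg)).
Qed.

Lemma integral_lapC f g : test_function f -> test_function g ->
  \int[mu]_(x in Q) (f x * lap g x) = \int[mu]_(x in Q) (lap f x * g x).
Proof.
move=> tf tg; apply: (etrans (integral_lap tf tg)); apply/esym.
transitivity (\int[mu]_(x in Q) (g x * lap f x)).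
  by apply: eq_Rintegral => x _; exact: mulrC.
apply: (etrans (integral_lap tg tf)); apply: (congr1 -%R); apply: eq_bigr => i _.
by apply: eq_Rintegral => x _; exact: mulrC.
Qed.

Lemma integral_iter_lapC j f g : test_function f -> test_function g ->
  \int[mu]_(x in Q) (iter j (@lap R d) f x * g x) =
  \int[mu]_(x in Q) (f x * iter j (@lap R d) g x).
Proof.
move=> tf; elim: j g => // j ih g tg.
have := ih _ (test_function_lap tg); rewrite -iterSr => <-.
exact: (esym (integral_lapC (test_function_iter_lap j tf) tg)).
Qed.

Lemma energy_test m f : smooth f ->
  energy m (test_jet f) (test_jet f) =
  if odd m then \int[mu]_(x in Q) \sum_i partials [:: i] (iter m./2 (@lap R d) f) x ^+ 2
  else \int[mu]_(x in Q) (iter m./2 (@lap R d) f x ^+ 2).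
Proof.
move=> sf; rewrite /energy /nabla_dot iter_laplacian_test//.
by case: (odd m); apply: eq_Rintegral => x _.
Qed.

(** All derivatives are moved onto one factor, in preparation for the upper bound. Moving Laplacians
    costs no sign; for odd m the remaining gradient contributes the factor -1. *)
Lemma energy_test_lap m f : test_function f ->
  energy m (test_jet f) (test_jet f) =
  (-1) ^+ m * \int[mu]_(x in Q) (f x * iter m (@lap R d) f x).
Proof.
move=> tf; have [sf _] := tf; rewrite energy_test//.
have tj := test_function_iter_lap m./2 tf; have [sj _] := tj.
case: ifPn => om; last first.
  rewrite -signr_odd (negbTE om) mul1r.
  transitivity (\int[mu]_(x in Q) (iter m./2 (@lap R d) f x * iter m./2 (@lap R d) f x)).
    by apply: eq_Rintegral => x _; exact: expr2.
  apply: (etrans (integral_iter_lapC m./2 tf tj)).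
  by rewrite -iterD addnn -[in RHS](odd_double_half m) (negbTE om).
rewrite -signr_odd om expr1 mulN1r.
transitivity (- \int[mu]_(x in Q) (iter m./2 (@lap R d) f x * lap (iter m./2 (@lap R d) f) x)).
  apply/esym; apply: (etrans (congr1 -%R (integral_lap tj tj))); rewrite opprK.
  apply: (etrans (esym (integral_sum_test (F := fun i => partials [:: i] (iter m./2 (@lap R d) f) \*
    partials [:: i] (iter m./2 (@lap R d) f)) _))).
    move=> i; have ti := test_function_partials [:: i] tj; have [si _] := ti.
    exact: (test_functionMr ti si).
  by apply: eq_Rintegral => x _; apply: eq_bigr => i _; rewrite expr2.
congr (- _); apply: (etrans (integral_iter_lapC m./2 tf (test_function_lap tj))).
by rewrite -iterS -iterD addnS addnn -[in RHS](odd_double_half m) om.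
Qed.

Lemma integral_sqr_ge0 f : 0 <= \int[mu]_(x in Q) (f x ^+ 2).
Proof. by apply: Rintegral_ge0 => x _; exact: sqr_ge0. Qed.

(** Write the Laplacian as a + b with a the i-th pure second derivative. Two integrations by parts
    turn each cross term, the integral of g_ii g_jj, into the integral of g_ij^2, so the mixed
    product of a and b has a nonnegative integral. *)
Lemma integral_lap_sqr_ge i g : test_function g ->
  \int[mu]_(x in Q) (partials [:: i; i] g x ^+ 2) <= \int[mu]_(x in Q) (lap g x ^+ 2).
Proof.
move=> tg; have [sg _] := tg.
pose a := partials [:: i; i] g.
pose b := fun x => \sum_(j | j != i) partials [:: j; j] g x.
have ta : test_function a := test_function_partials [:: i; i] tg.
have tb : test_function b.
  by apply: test_function_sum => j; exact: (test_function_partials [:: j; j] tg).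
have [sa _] := ta; have [sb _] := tb.
have cross j : \int[mu]_(x in Q) (a x * partials [:: j; j] g x) =
    \int[mu]_(x in Q) (partials [:: i; j] g x ^+ 2).
  transitivity (- \int[mu]_(x in Q) (partials [:: i] (partials [:: j; i] g) x * partials [:: j] g x)).
    rewrite (integral_partialMr j ta (smooth_partials [:: j] sg)).
    apply: (congr1 -%R); apply: eq_Rintegral => x _.
    apply: (congr1 (fun z => z * partials [:: j] g x)).
    exact: (congr1 (@^~ x) (partialC j i (smooth_partials [:: i] sg))).
  have E := integral_partialMr i (test_function_partials [:: j] tg) (smooth_partials [:: j; i] sg).
  transitivity (- - \int[mu]_(x in Q) (partials [:: i; j] g x * partials [:: j; i] g x)).
    apply: (congr1 -%R); apply: etrans E.
    by apply: eq_Rintegral => x _; exact: mulrC.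
  rewrite opprK; apply: eq_Rintegral => x _.
  rewrite expr2; apply: (congr1 (fun z => partials [:: i; j] g x * z)).
  exact: (congr1 (@^~ x) (partialC j i sg)).
have ab_ge0 : 0 <= \int[mu]_(x in Q) (a x * b x).
  rewrite (_ : (fun x => a x * b x) = fun x => \sum_j (if j != i then (a x * partials [:: j; j] g x) else 0)); last first.
    by apply/funext => x; rewrite mulr_sumr big_mkcond.
  rewrite (integral_sum_test (F := fun j x => if j != i then (a x * partials [:: j; j] g x) else 0)).
    apply: sumr_ge0 => j _; case: (j != i); first by rewrite cross integral_sqr_ge0.
    exact: Rintegral_ge0.
  move=> j; case: (j != i).
    by apply: (test_functionMr ta); exact: (smooth_partials [:: j; j] sg).
  split; first exact: smooth_cst.
  by exists set0; split => //; exact: compact0.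
have mQ := @measurable_hypercube R d.
have taa := test_functionMr ta sa; have tab := test_functionMr ta sb.
have tbb := test_functionMr tb sb.
have tlap := test_function_lap tg; have [slap _] := tlap.
apply: (@le_trans _ _ (\int[mu]_(x in Q) (a x ^+ 2 + (a x * b x + a x * b x)))).
  rewrite RintegralD//; last 2 first.
  - exact: (test_function_integrable taa).
  - exact: (test_function_integrable (test_functionD tab tab)).
  rewrite lerDl RintegralD//; last 2 first.
  - exact: (test_function_integrable tab).
  - exact: (test_function_integrable tab).
  by rewrite addr_ge0.
apply: le_Rintegral => //.
- exact: (test_function_integrable (test_functionD taa (test_functionD tab tab))).
- exact: (test_function_integrable (test_functionMr tlap slap)).
- move=> x _; have -> : lap g x = a x + b x by rewrite /lap (bigD1 i).
  by rewrite sqrrD mulr2n lerDl sqr_ge0.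
Qed.

(** Each Laplacian is traded for two derivatives in direction i. The parameter k carries the
    derivatives already gained, and also the single gradient left over when m is odd. *)
Lemma integral_iter_lap_sqr_ge i k j f : test_function f ->
  \int[mu]_(x in Q) (partials (nseq (k + j.*2) i) f x ^+ 2) <=
  \int[mu]_(x in Q) (partials (nseq k i) (iter j (@lap R d) f) x ^+ 2).
Proof.
move=> tf; elim: j k => [|j ih] k; first by rewrite addn0.
have tlj := test_function_iter_lap j tf; have [slj _] := tlj.
rewrite doubleS -!addSnnS; apply: (le_trans (ih k.+2)).
rewrite iterS partials_lap//.
exact: (integral_lap_sqr_ge i (test_function_partials (nseq k i) tlj)).
Qed.

Lemma energy_test_ge i m f : test_function f ->
  \int[mu]_(x in Q) (partials (nseq m i) f x ^+ 2) <= energy m (test_jet f) (test_jet f).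
Proof.
move=> tf; have [sf _] := tf; rewrite energy_test//.
have tj := test_function_iter_lap m./2 tf.
have tdj l : test_function (fun x => partials [:: l] (iter m./2 (@lap R d) f) x ^+ 2).
  rewrite (_ : (fun x => _) = partials [:: l] (iter m./2 (@lap R d) f) \*
    partials [:: l] (iter m./2 (@lap R d) f)); last first.
    by apply/funext => x; rewrite expr2.
  have tl := test_function_partials [:: l] tj; have [sl _] := tl.
  exact: (test_functionMr tl sl).
rewrite -[X in nseq X i]odd_double_half; apply: (le_trans (integral_iter_lap_sqr_ge _ _ _ tf)).
case: (odd m) => //=.
apply: le_Rintegral => //.
- exact: measurable_hypercube.
- exact: (test_function_integrable (tdj i)).
- exact: (test_function_integrable (test_function_sum _ _ tdj)).
- by move=> x _; rewrite (bigD1 i)//= lerDl sumr_ge0// => l _; exact: sqr_ge0.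
Qed.

End test_jets.

(** * The one-dimensional inequality *)

Section weighted_inequality.
Variables (R : realType) (b : R).
Hypothesis b1 : 1 < b.
Local Notation leb := (@lebesgue_measure R).
Local Notation I := `[(-1 : R)%R, (1 : R)%R].

Let V (x : R) : R := (b ^+ 2 - x ^+ 2)^-1.

Let W_gt0 x : x \in I -> 0 < b ^+ 2 - x ^+ 2.
Proof. rewrite in_itv/= => /andP[h1 h2]; move: b1; nra. Qed.

Let is_derive_V x : x \in I -> is_derive x (1 : R) V (2 * x * V x ^+ 2).
Proof.
move=> xI; have W0 := W_gt0 xI.
have dW : is_derive x (1 : R) (fun x : R => b ^+ 2 - x ^+ 2) (- (2 * x)).
  apply: is_derive_eq; rewrite /GRing.scale/=; ring.
have W0' : b ^+ 2 - x ^+ 2 != 0 by rewrite gt_eqF.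
apply: is_derive_eq; first exact: (is_deriveV (f := fun x : R => b ^+ 2 - x ^+ 2) W0' dW).
rewrite /V /GRing.scale/= exprVn; ring.
Qed.

Let is_derive_Vn x n : x \in I ->
  is_derive x (1 : R) (fun x => V x ^+ n) (2 * n%:R * x * V x ^+ n.+1).
Proof.
move=> xI; have dV := is_derive_V xI; elim: n => [|n ih].
  rewrite (_ : (fun x => _) = cst 1); last by apply/funext => y; rewrite expr0.
  apply: is_derive_eq; ring.
rewrite (_ : (fun x => _) = (V \* (fun x => V x ^+ n))); last first.
  by apply/funext => y; rewrite exprS.
apply: is_derive_eq; rewrite /GRing.scale/= !exprS -natr1; ring.
Qed.

Let within_continuous (f df : R -> R) :
  (forall x, x \in I -> is_derive x (1 : R) f (df x)) -> {within [set` I], continuous f}.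
Proof.
move=> h; apply: continuous_in_subspaceT => x; rewrite inE => xI.
by apply: differentiable_continuous; apply/derivable1_diffP; case: (h x xI).
Qed.

(** For q = u^(j) and k = m - j this is the J_j of the overview. *)
Let A (q : R -> R) k : R := \int[leb]_(x in [set` I]) (q x ^+ 2 * V x ^+ k).

Let A_integrable (f : R -> R) : {within [set` I], continuous f} ->
  leb.-integrable [set` I] (EFin \o f).
Proof. by move=> cf; apply: continuous_compact_integrable => //; exact: segment_compact. Qed.

Let continuous_weight (q : R -> R) k : {within [set` I], continuous q} ->
  {within [set` I], continuous (fun x => q x ^+ 2 * V x ^+ k)}.
Proof.
move=> cq x; apply: cvgM; first exact: (cvgM (cq x) (cq x)).
exact: (within_continuous (@is_derive_Vn ^~ k)).
Qed.

(* Integrating ((b^2 - x^2) r + 2 (k + 1) x q + c p)^2 V^(k + 2) >= 0, where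
   the factor vanishes for p, q, r the derivatives of order j - 1, j, j + 1 of
   (b^2 - x^2)^m, k = m - j - 1 and c = j (2 m - j + 1). *)
Let weighted_step k (c : R) (p p' q r : R -> R) :
  (forall x, is_derive x (1 : R) p (p' x)) ->
  (forall x, is_derive x (1 : R) q (r x)) ->
  (forall x, c * p' x = c * q x) ->
  continuous r -> q (-1) = 0 -> q 1 = 0 ->
  (2 * k.+1%:R + 2 * c) * A q k.+1 <= A r k + c ^+ 2 * A p k.+2.
Proof.
move=> dp dq pq cr qN1 q1.
have cont (f df : R -> R) : (forall x, is_derive x (1 : R) f (df x)) -> {within [set` I], continuous f}.
  by move=> h; apply: (@within_continuous _ df) => x _.
have cp := cont _ _ dp; have cq := cont _ _ dq.
have {}cr : {within [set` I], continuous r} by exact: continuous_subspaceT.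
pose S x := ((b ^+ 2 - x ^+ 2) * r x + 2 * k.+1%:R * x * q x + c * p x) ^+ 2 * V x ^+ k.+2.
(* G is chosen so that its derivative is g: it produces the cross terms and the x^2 q^2 term of the
   expanded square S, plus (2 (k + 1) + 2 c) q^2 V^(k+1). Since q vanishes at both endpoints, so
   does G, and g has integral 0. *)
pose G x := (2 * k.+1%:R * x * q x ^+ 2 + 2 * c * p x * q x) * V x ^+ k.+1.
pose g x := S x + ((2 * k.+1%:R + 2 * c) * (q x ^+ 2 * V x ^+ k.+1) -
  (r x ^+ 2 * V x ^+ k + c ^+ 2 * (p x ^+ 2 * V x ^+ k.+2))).
have cwt := continuous_weight.
have cS : {within [set` I], continuous S}.
  move=> x; apply: cvgM; last exact: (within_continuous (@is_derive_Vn ^~ k.+2)).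
  suff cR : {within [set` I], continuous (fun x => (b ^+ 2 - x ^+ 2) * r x + 2 * k.+1%:R * x * q x + c * p x)}.
    exact: (cvgM (cR x) (cR x)).
  move=> {}x; apply: cvgD; last by apply: cvgM; [exact: cvg_cst|exact: cp].
  have cid : {within [set` I], continuous (fun x : R => x)}.
    by apply: (cont _ (fun=> 1)) => y; exact: is_derive_id.
  apply: cvgD.
    apply: cvgM; last exact: cr.
    by apply: cvgB; [exact: cvg_cst|exact: (cvgM (cid x) (cid x))].
  apply: cvgM; last exact: cq.
  by apply: cvgM; [exact: cvg_cst|exact: cid].
have cE : {within [set` I], continuous (fun x => (2 * k.+1%:R + 2 * c) * (q x ^+ 2 * V x ^+ k.+1) -
    (r x ^+ 2 * V x ^+ k + c ^+ 2 * (p x ^+ 2 * V x ^+ k.+2)))}.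
  move=> x; apply: cvgB; first by apply: cvgM; [exact: cvg_cst|exact: cwt].
  apply: cvgD; first exact: cwt.
  by apply: cvgM; [exact: cvg_cst|exact: cwt].
have cg : {within [set` I], continuous g}.
  by move=> x; apply: cvgD; [exact: cS|exact: cE].
have dG x : x \in I -> is_derive x (1 : R) G (g x).
  move=> xI; have W0 := W_gt0 xI.
  have := is_derive_Vn k.+1 xI; have := dp x; have := dq x => dq_ dp_ dV_.
  apply: is_derive_eq.
  have WV : (b ^+ 2 - x ^+ 2) * V x = 1 by rewrite /V divff// gt_eqF.
  have pqx := pq x.
  rewrite /g /S /GRing.scale/=.
  have -> : ((b ^+ 2 - x ^+ 2) * r x + 2 * k.+1%:R * x * q x + c * p x) ^+ 2 * V x ^+ k.+2 =
    (((b ^+ 2 - x ^+ 2) * V x) * r x + 2 * k.+1%:R * x * q x * V x + c * p x * V x) ^+ 2 * V x ^+ k.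
    by rewrite !exprS; ring.
  rewrite WV !exprS.
  ring: pqx.
have intg : \int[leb]_(x in [set` I]) g x = 0.
  rewrite /Rintegral (integral_derive _ cg dG)/=; last lra.
  by rewrite /G q1 qN1; ring.
have S0 : 0 <= \int[leb]_(x in [set` I]) S x.
  apply: Rintegral_ge0 => x xI; rewrite mulr_ge0 ?sqr_ge0// exprn_ge0// /V invr_ge0.
  by rewrite ltW// W_gt0.
move: intg; rewrite RintegralD; [|exact: measurable_itv|exact: A_integrable..].
rewrite RintegralB; [|exact: measurable_itv|apply: A_integrable..]; last 2 first.
- by move=> x; apply: cvgM; [exact: cvg_cst|exact: cwt].
- move=> x; apply: cvgD; first exact: cwt.
  by apply: cvgM; [exact: cvg_cst|exact: cwt].
rewrite RintegralD; [|exact: measurable_itv|apply: A_integrable..]; last 2 first.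
- exact: cwt.
- by move=> x; apply: cvgM; [exact: cvg_cst|exact: cwt].
rewrite RintegralZl; [|exact: measurable_itv|apply: A_integrable; exact: cwt].
rewrite RintegralZl; [|exact: measurable_itv|apply: A_integrable; exact: cwt].
rewrite -/(A q k.+1) -/(A r k) -/(A p k.+2); move: S0.
move: (A q k.+1) (A r k) (A p k.+2) (\int[leb]_(x in _) S x) => a1 a2 a3 a4.
move=> a40 /eqP; rewrite addr_eq0 => /eqP a4E; rewrite a4E in a40.
by rewrite -subr_ge0 -opprB.
Qed.

Variables (m : nat) (u : nat -> R -> R).
Hypothesis du : forall j x, is_derive x (1 : R) (u j) (u j.+1 x).
Hypothesis uN1 : forall j, u j (-1) = 0.
Hypothesis u1 : forall j, u j 1 = 0.

Let cu j : continuous (u j).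
Proof.
move=> x; apply: differentiable_continuous; apply/derivable1_diffP.
by case: (du j x).
Qed.

(** W^m solves W u' + 2 m x u = 0. Differentiating this equation j times gives W u^(j+1) + 2 (m - j)
    x u^(j) + [c j] u^(j-1) = 0. *)
Let c j : R := j%:R * (2 * m%:R - j%:R + 1).

(** The induction hypothesis, multiplied by [c j.+1], bounds the term with the square of [c j.+1] in
    [weighted_step] by one copy of [c j.+1 * A (u j.+1) k.+1]. Of the two copies on the left one
    remains, and 2 (k + 1) + [c j.+1] = [c j.+2]. *)
Let ladder j k : (j + k.+1 = m)%N -> c j.+1 * A (u j) k.+1 <= A (u j.+1) k.
Proof.
elim: j k => [|j ih] k jk.
  (* At order 0 there is no function u^(-1): take p = p' = 0 and c = 0. This is why [weighted_step]
     asks for c p' = c q instead of p' = q. *)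
  have d0 x : is_derive x (1 : R) (fun=> 0 : R) 0 by exact: is_derive_cst.
  have := @weighted_step k 0 (fun=> 0) (fun=> 0) (u 0%N) (u 1%N) d0 (du 0) _ (@cu 1) (uN1 _) (u1 _).
  move=> /(_ (fun x => etrans (mul0r _) (esym (mul0r _)))).
  rewrite expr0n mul0r addr0 mulr0 addr0.
  suff -> : c 1%N = 2 * k.+1%:R by [].
  by rewrite /c -jk add0n -!natr1; ring.
have jk2 : (j + k.+2 = m)%N by rewrite -jk addSnnS.
have := ih k.+1 jk2.
have := @weighted_step k (c j.+1) (u j) (u j.+1) (u j.+1) (u j.+2) (du j) (du j.+1) _ (@cu j.+2) (uN1 _) (u1 _).
have cE : 2 * k.+1%:R + c j.+1 = c j.+2 by rewrite /c -jk2 !natrD -!natr1; ring.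
move=> /(_ (fun=> erefl)); rewrite -cE.
have c0 : 0 <= c j.+1.
  rewrite /c mulr_ge0// -jk2 natrD -!natr1; have := ler0n R j; have := ler0n R k; lra.
move: (A (u j) k.+2) (A (u j.+1) k.+1) (A (u j.+2) k) => a1 a2 a3 h1 h2.
have := ler_wpM2l c0 h2; nra.
Qed.

(** Since [c j.+1] = (j + 1)(2 m - j), the product of the constants is a factorial times a falling
    factorial; for j = m it equals (2 m)!. *)
Let iterated_ladder j k : (j + k = m)%N ->
  (j`! * (2 * m) ^_ j)%:R * A (u 0) m <= A (u j) k.
Proof.
elim: j k => [|j ih] k jk; first by rewrite -[k]/(0 + k)%N jk fact0 ffactn0 mul1r.
have jk' : (j + k.+1 = m)%N by rewrite -jk addSnnS.
apply: le_trans (ladder jk').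
have jm : (j <= 2 * m)%N by rewrite -jk' mulSn -addnA leq_addr.
have cE : c j.+1 = ((j.+1)%:R * (2 * m - j)%:R).
  by rewrite /c natrB// natrM -natr1; ring.
have c0 : 0 <= c j.+1 by rewrite cE mulr_ge0.
apply: le_trans (ler_wpM2l c0 (ih _ jk')).
rewrite mulrA cE factS ffactnSr !natrM le_eqVlt; apply/orP; left; apply/eqP; ring.
Qed.

(** The denominator comes from V >= b^(-2), which removes the weight V^m from the left side; it
    tends to 1 with b. *)
Lemma derivative_norm_ge :
  (2 * m)`!%:R / b ^+ (2 * m) * (\int[leb]_(x in [set` I]) (u 0 x ^+ 2)) <=
  \int[leb]_(x in [set` I]) (u m x ^+ 2).
Proof.
have cun j : {within [set` I], continuous (u j)} by exact: continuous_subspaceT.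
have csq j : {within [set` I], continuous (fun x => u j x ^+ 2)}.
  by move=> x; exact: (cvgM (cun j x) (cun j x)).
have := iterated_ladder (addn0 m).
have -> : (m`! * (2 * m) ^_ m = (2 * m)`!)%N.
  by rewrite mulnC -(ffact_fact (_ : m <= 2 * m)%N) ?leq_pmull// mul2n -addnn addnK.
have -> : A (u m) 0 = \int[leb]_(x in [set` I]) (u m x ^+ 2).
  by apply: eq_Rintegral => x _; rewrite expr0 mulr1.
apply: le_trans; rewrite -mulrA ler_wpM2l//.
rewrite -RintegralZl; [|exact: measurable_itv|exact: A_integrable].
apply: le_Rintegral; [exact: measurable_itv|apply: A_integrable..|].
- by move=> x; apply: cvgM; [exact: cvg_cst|exact: csq].
- exact: continuous_weight.
move=> x xI; rewrite mulrC ler_wpM2l ?sqr_ge0// exprM -exprVn.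
have W0 := W_gt0 xI; have b20 : 0 < b ^+ 2 by move: b1; nra.
rewrite lerXn2r ?nnegrE ?invr_ge0 ?(ltW W0) ?(ltW b20)// /V lef_pV2 ?posrE//.
by rewrite lerBlDr lerDl sqr_ge0.
Qed.

End weighted_inequality.

(** * From segments to the cube *)

Section lower_bound.
Variables (R : realType) (n : nat).
Local Notation Rd := 'rV[R]_n.+1.
Local Notation mu := (@lebesgue_measure_rV R n.+1).
Local Notation leb := (@lebesgue_measure R).
Local Notation Q := (@hypercube R n.+1).
Implicit Types (f g : Rd -> R).

Let continuous_slice g x : smooth g -> continuous (fun t => g (rV_cons (x, t))).
Proof.
move=> sg t; apply: (@continuous_comp _ _ _ (fun t => rV_cons (x, t))).
  exact: rV_cons_continuousr.
exact: smooth_continuous.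
Qed.

Let slice_norm g x : test_function g ->
  (\int[leb]_t ((g (rV_cons (x, t))) ^+ 2)%:E =
  (\int[leb]_(t in `[(-1)%R, 1%R]) (g (rV_cons (x, t)) ^+ 2))%:E)%E.
Proof.
move=> tg; have [sg _] := tg; have cg := @continuous_slice _ x sg.
rewrite (@integral_itvT _ (fun t => g (rV_cons (x, t)) ^+ 2)); last first.
  move=> t t1; rewrite (test_function_out tg) ?expr0n//.
  by move=> /hypercube_rV_cons[_].
rewrite /Rintegral fineK//; apply: integrable_fin_num; first exact: measurable_itv.
apply: continuous_compact_integrable; first exact: segment_compact.
by apply: continuous_subspaceT => t; exact: (cvgM (cg t) (cg t)).
Qed.

Let slices_norm g : test_function g ->
  ((\int[mu]_(x in Q) (g x ^+ 2))%:E =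
  \int[@lebesgue_measure_rV R n]_x
    (\int[leb]_(t in `[(-1)%R, 1%R]) (g (rV_cons (x, t)) ^+ 2))%:E)%E.
Proof.
move=> tg; have [sg _] := tg.
have tgg := test_functionMr tg sg; have [sgg _] := tgg.
have fin : (\int[mu]_(x in Q) (g x ^+ 2)%:E \is a fin_num)%E.
  apply: integrable_fin_num; first exact: measurable_hypercube.
  rewrite (_ : (fun x => _) = EFin \o (g \* g)); first exact: test_function_integrable.
  by apply/funext => x; rewrite /= expr2.
rewrite /Rintegral fineK// integral_hypercubeT; last first.
  by move=> x Qx; rewrite (test_function_out tg Qx) expr0n.
rewrite tonelli_rV; first last.
- by move=> x; rewrite lee_fin sqr_ge0.
- apply/measurable_EFinP; apply: continuous_measurable_rV => x.
  exact: (smooth_continuous sgg).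
by apply: eq_integral => x _; exact: slice_norm.
Qed.

Let measurable_slices_norm g : test_function g ->
  measurable_fun [set: 'rV[R]_n] (fun x =>
    (\int[leb]_(t in `[(-1)%R, 1%R]) (g (rV_cons (x, t)) ^+ 2))%:E)%E.
Proof.
move=> tg; have [sg _] := tg.
have tgg := test_functionMr tg sg; have [sgg _] := tgg.
rewrite (_ : (fun x => _) = (fun x => \int[leb]_t ((g (rV_cons (x, t))) ^+ 2)%:E)%E); last first.
  by apply/funext => x; rewrite slice_norm.
apply: (@measurable_tonelli_rV R n (fun x => (g x ^+ 2)%:E)).
- apply/measurable_EFinP; apply: continuous_measurable_rV => x.
  exact: (smooth_continuous sgg).
- by move=> x; rewrite lee_fin sqr_ge0.
Qed.

(** The direction [ord0] is the coordinate that [rV_cons] adds, hence the one along which Tonelli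
    slices the cube. The one-dimensional inequality is applied on every slice for a fixed b > 1, and
    b decreases to 1 only after the integration. *)
Lemma partial0_norm_ge m f : test_function f ->
  (2 * m)`!%:R * \int[mu]_(x in Q) (f x ^+ 2) <=
  \int[mu]_(x in Q) (partials (nseq m ord0) f x ^+ 2).
Proof.
move=> tf; have [sf _] := tf.
have tdf := test_function_partials (nseq m ord0) tf.
have key (b : R) : 1 < b -> (2 * m)`!%:R * \int[mu]_(x in Q) (f x ^+ 2) <=
    b ^+ (2 * m) * \int[mu]_(x in Q) (partials (nseq m ord0) f x ^+ 2).
  move=> b1; have bm0 : 0 < b ^+ (2 * m) by rewrite exprn_gt0// (lt_trans ltr01).
  rewrite -ler_pdivrMl// mulrA [_^-1 * _]mulrC.
  set C := _ / _; have C0 : 0 <= C by rewrite divr_ge0// ltW.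
  rewrite -lee_fin EFinM !slices_norm//.
  rewrite -ge0_integralZl//; last first.
  - by move=> x _; rewrite lee_fin Rintegral_ge0// => t _; exact: sqr_ge0.
  - exact: measurable_slices_norm.
  apply: ge0_le_integral => //.
  - move=> x _; rewrite -EFinM lee_fin mulr_ge0// Rintegral_ge0// => t _.
    exact: sqr_ge0.
  - by apply: measurable_funeM; exact: measurable_slices_norm.
  - exact: measurable_slices_norm.
  - move=> x _; rewrite -EFinM lee_fin.
    have := @derivative_norm_ge R b b1 m (fun j t => partials (nseq j ord0) f (rV_cons (x, t))).
    apply.
    + move=> j t; apply: is_derive_rV_cons0.
      exact: (smooth_derivable (smooth_partials (nseq j ord0) sf)).
    + move=> j; apply: (test_function_out (test_function_partials (nseq j ord0) tf)).
      by move=> /hypercube_rV_cons[_]; rewrite ltxx.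
    + move=> j; apply: (test_function_out (test_function_partials (nseq j ord0) tf)).
      by move=> /hypercube_rV_cons[_]; rewrite ltxx andbF.
set A := \int[mu]_(x in Q) _; set B := \int[mu]_(x in Q) _.
have B0 : 0 <= B by apply: Rintegral_ge0 => x _; exact: sqr_ge0.
apply: (@cvgr_to_ge _ (1 : R)^'+ _ _ (fun b : R => b ^+ (2 * m) * B)).
  rewrite -[X in _ --> X]mul1r -[X in X * _](expr1n _ (2 * m)).
  apply: cvgMr_tmp; apply: cvg_at_right_filter; exact: exprn_continuous.
near=> b; apply: key; near: b; exact: nbhs_right_gt.
Unshelve. all: by end_near. Qed.

End lower_bound.

(** * Passage to the limit *)

Section mean_square_convergence.
Variables (R : realType) (d : nat).
Local Notation Rd := 'rV[R]_d.
Local Notation mu := (@lebesgue_measure_rV R d).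
Local Notation Q := (@hypercube R d).
Implicit Types (f g : Rd -> R).

Let mQ : measurable Q := @measurable_hypercube R d.

Lemma square_integrableD f g : square_integrable f -> square_integrable g ->
  square_integrable (f \+ g).
Proof.
move=> [mf intf] [mg intg]; split; first exact: measurable_funD.
have int2 : mu.-integrable Q (EFin \o (fun x => 2 * (f x ^+ 2) + 2 * (g x ^+ 2))).
  exact: (integrableD mQ (integrableZl mQ 2 intf) (integrableZl mQ 2 intg)).
apply: le_integrable int2 => //.
  apply/measurable_EFinP; apply: measurable_funX; exact: measurable_funD.
move=> x _; rewrite !abse_EFin !lee_fin ger0_norm ?sqr_ge0//.
apply: le_trans (ler_norm _); have := sqr_ge0 (f x - g x); rewrite /=; nra.
Qed.

Lemma square_integrableN f : square_integrable f -> square_integrable (fun x => - f x).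
Proof.
move=> [mf intf]; split; first exact: measurableT_comp.
by apply: eq_integrable intf => // x _; rewrite sqrrN.
Qed.

Lemma square_integrableB f g : square_integrable f -> square_integrable g ->
  square_integrable (fun x => f x - g x).
Proof. by move=> sf sg; apply: square_integrableD => //; exact: square_integrableN. Qed.

Definition mean_square_cvg (f : nat -> Rd -> R) g :=
  [/\ forall k, square_integrable (f k), square_integrable g &
  (fun k => \int[mu]_(x in Q) ((f k x - g x) ^+ 2)) @ \oo --> (0 : R)].

Lemma mean_square_cvgD (f1 : nat -> Rd -> R) g1 (f2 : nat -> Rd -> R) g2 : mean_square_cvg f1 g1 -> mean_square_cvg f2 g2 ->
  mean_square_cvg (fun k => f1 k \+ f2 k) (g1 \+ g2).
Proof.
move=> [sf1 sg1 c1] [sf2 sg2 c2]; split.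
- by move=> k; exact: square_integrableD.
- exact: square_integrableD.
pose h k := 2 * \int[mu]_(x in Q) ((f1 k x - g1 x) ^+ 2) +
  2 * \int[mu]_(x in Q) ((f2 k x - g2 x) ^+ 2).
apply: (@squeeze_cvgr _ _ _ _ (fun=> 0) h); last 2 first.
- exact: cvg_cst.
- have : h @ \oo --> 2 * (0 : R) + 2 * 0 by apply: cvgD; apply: cvgMl_tmp.
  by rewrite mulr0 addr0.
near=> k; apply/andP; split; first by apply: Rintegral_ge0 => x _; exact: sqr_ge0.
have [_ i1] := square_integrableB (sf1 k) sg1.
have [_ i2] := square_integrableB (sf2 k) sg2.
have [_ i3] := square_integrableB (square_integrableD (sf1 k) (sf2 k)) (square_integrableD sg1 sg2).
rewrite /h -RintegralZl// -RintegralZl// -RintegralD//; [|exact: (integrableZl mQ 2 i1)|exact: (integrableZl mQ 2 i2)].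
apply: le_Rintegral => //.
  exact: (integrableD mQ (integrableZl mQ 2 i1) (integrableZl mQ 2 i2)).
move=> x _; rewrite /=; have := sqr_ge0 ((f1 k x - g1 x) - (f2 k x - g2 x)); nra.
Unshelve. all: by end_near. Qed.

Lemma mean_square_cvg_sum (I : Type) (r : seq I) (f : I -> nat -> Rd -> R) (g : I -> Rd -> R) :
  (forall i, mean_square_cvg (f i) (g i)) ->
  mean_square_cvg (fun k x => \sum_(i <- r) f i k x) (fun x => \sum_(i <- r) g i x).
Proof.
move=> fg; elim: r => [|i r ih].
  rewrite (_ : (fun k x => _) = fun _ _ => 0); last first.
    by apply/funext => k; apply/funext => x; rewrite big_nil.
  rewrite (_ : (fun x => _) = fun=> 0); last by apply/funext => x; rewrite big_nil.
  have s0 : square_integrable (fun _ : Rd => 0 : R).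
    split; first exact: measurable_cst.
    rewrite (_ : (fun x => _) = cst 0%E); first exact: integrable0.
    by apply/funext => x; rewrite expr0n.
  split => //; rewrite (_ : (fun n => _) = fun=> 0); first exact: cvg_cst.
  by apply/funext => k; rewrite /Rintegral integral0_eq// => x _; rewrite subrr expr0n.
rewrite (_ : (fun k x => _) = fun k => f i k \+ (fun x => \sum_(i <- r) f i k x)); last first.
  by apply/funext => k; apply/funext => x; rewrite big_cons.
rewrite (_ : (fun x => _) = g i \+ (fun x => \sum_(i <- r) g i x)).
  exact: mean_square_cvgD.
by apply/funext => x; rewrite big_cons.
Qed.

Lemma mean_square_cvg_norm (f : nat -> Rd -> R) g : mean_square_cvg f g ->
  (fun k => \int[mu]_(x in Q) (f k x ^+ 2)) @ \oo --> \int[mu]_(x in Q) (g x ^+ 2).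
Proof.
move=> [sf sg c]; apply/cvgrPdist_le => e e0.
set G := \int[mu]_(x in Q) (g x ^+ 2).
have G0 : 0 <= G by apply: Rintegral_ge0 => x _; exact: sqr_ge0.
(* Weighted Young inequality: |b^2 - a^2| <= (1 + 1/eta)(a - b)^2 + eta b^2. This eta makes the last
   term contribute at most e/2, with G + 1 in place of G to allow G = 0; the first term is small by
   mean square convergence. *)
pose eta := e / (2 * (G + 1)).
have eta0 : 0 < eta by rewrite divr_gt0// mulr_gt0// ltr_wpDl.
have etaG : eta * G <= e / 2.
  rewrite /eta mulrAC ler_pdivrMr ?mulr_gt0 ?ltr_wpDl//.
  rewrite [leRHS](_ : _ = e * G + e); last by field.
  by rewrite lerDl ltW.
pose K := 1 + eta^-1.
have K0 : 0 < K by rewrite addr_gt0// invr_gt0.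
have eK : 0 < e / 2 / K by rewrite !divr_gt0.
have /cvgrPdist_le/(_ _ eK) := c; apply: filterS => k.
rewrite sub0r normrN ger0_norm; last by apply: Rintegral_ge0 => x _; exact: sqr_ge0.
rewrite ler_pdivlMr// => D_le.
have [_ i1] := sf k; have [_ i2] := sg.
have [_ i3] := square_integrableB (sf k) sg.
have i4 : mu.-integrable Q (EFin \o (fun x => K * (f k x - g x) ^+ 2)) := integrableZl mQ K i3.
have i5 : mu.-integrable Q (EFin \o (fun x => eta * g x ^+ 2)) := integrableZl mQ eta i2.
have i6 : mu.-integrable Q (EFin \o (fun x => K * (f k x - g x) ^+ 2 + eta * g x ^+ 2)).
  exact: (integrableD mQ i4 i5).
have bound : \int[mu]_(x in Q) (K * (f k x - g x) ^+ 2 + eta * g x ^+ 2) <= e.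
  rewrite RintegralD// !RintegralZl//.
  by rewrite mulrC [leRHS](splitr e) lerD.
have pt (a b : R) : `|b ^+ 2 - a ^+ 2| <= K * (a - b) ^+ 2 + eta * b ^+ 2.
  have key : eta * b ^+ 2 + eta^-1 * (a - b) ^+ 2 - 2 * b * (a - b) =
      eta * (b - eta^-1 * (a - b)) ^+ 2 by field; rewrite gt_eqF.
  have key' : eta * b ^+ 2 + eta^-1 * (a - b) ^+ 2 + 2 * b * (a - b) =
      eta * (b + eta^-1 * (a - b)) ^+ 2 by field; rewrite gt_eqF.
  have p1 : 0 <= eta * (b - eta^-1 * (a - b)) ^+ 2 by rewrite mulr_ge0 ?sqr_ge0// ltW.
  have p2 : 0 <= eta * (b + eta^-1 * (a - b)) ^+ 2 by rewrite mulr_ge0 ?sqr_ge0// ltW.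
  have p3 := sqr_ge0 (a - b).
  rewrite ler_norml /K; apply/andP; split; nra.
rewrite /G -RintegralB//; apply: le_trans bound.
have i7 : mu.-integrable Q (EFin \o (fun x => g x ^+ 2 - f k x ^+ 2)) by exact: (integrableB mQ i2 i1).
apply: le_trans (le_normr_Rintegral mQ i7) _; apply: le_Rintegral => //.
exact: integrable_norm.
Qed.

End mean_square_convergence.

Section energy_limit.
Variables (R : realType) (d : nat).
Local Notation Rd := 'rV[R]_d.
Local Notation mu := (@lebesgue_measure_rV R d).
Local Notation Q := (@hypercube R d).
Local Notation L := (@laplacian R d).
Variables (m : nat) (f : nat -> Rd -> R) (U : jet R d).
Hypothesis fU : forall s, (size s <= m)%N ->
  mean_square_cvg (fun k => partials s (f k)) (U s).

(** The bound on [size s + j.*2] ensures that only words of length at most m are read, the ones on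
    which convergence is known. *)
Lemma mean_square_cvg_laplacian j s : (size s + j.*2 <= m)%N ->
  mean_square_cvg (fun k => iter j L (test_jet (f k)) s) (iter j L U s).
Proof.
elim: j s => [|j ih] s sm; first by apply: fU; rewrite addn0 in sm.
have ihi i := ih [:: i, i & s] (_ : (size s).+2 + j.*2 <= m)%N.
apply: (@mean_square_cvg_sum R d _ _ (fun i k => iter j L (test_jet (f k)) [:: i, i & s])
  (fun i => iter j L U [:: i, i & s])).
by move=> i; apply: ihi; move: sm; rewrite doubleS !addnS !addSn.
Qed.

Lemma Rintegral_sum_sqr (F : 'I_d -> Rd -> R) : (forall i, square_integrable (F i)) ->
  \int[mu]_(x in Q) (\sum_i F i x * F i x) = \sum_i \int[mu]_(x in Q) (F i x ^+ 2).
Proof.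
move=> sF.
have mQ := @measurable_hypercube R d.
have iF i : mu.-integrable Q (EFin \o (fun x => F i x ^+ 2)) by case: (sF i).
suff : forall r : seq 'I_d, mu.-integrable Q (EFin \o (fun x => \sum_(i <- r) F i x ^+ 2)) /\
   \int[mu]_(x in Q) (\sum_(i <- r) F i x ^+ 2) = \sum_(i <- r) \int[mu]_(x in Q) (F i x ^+ 2).
  by move=> h; have [_ <-] := h (index_enum _); apply: eq_Rintegral => x _.
elim=> [|i r [ir ihr]].
  rewrite big_nil; split.
    rewrite (_ : _ \o _ = cst 0%E); first exact: integrable0.
    by apply/funext => x; rewrite /= big_nil.
  by rewrite /Rintegral integral0_eq// => x _; rewrite big_nil.
have E : (fun x => \sum_(j <- i :: r) F j x ^+ 2) = (fun x => F i x ^+ 2 + \sum_(j <- r) F j x ^+ 2).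
  by apply/funext => x; rewrite big_cons.
rewrite E; split; first exact: (integrableD mQ (iF i) ir).
by rewrite RintegralD// big_cons ihr.
Qed.

Lemma energy_cvg :
  (fun k => energy m (test_jet (f k)) (test_jet (f k))) @ \oo --> energy m U U.
Proof.
rewrite /energy /nabla_dot.
have m2 := odd_double_half m.
case: (odd m) m2 => m2; last first.
  apply: (mean_square_cvg_norm (mean_square_cvg_laplacian (s := [::]) _)).
  by rewrite -[X in (_ <= X)%N]m2.
have c1 i : mean_square_cvg (fun k => iter m./2 L (test_jet (f k)) [:: i]) (iter m./2 L U [:: i]).
  by apply: mean_square_cvg_laplacian; rewrite -[X in (_ <= X)%N]m2.
rewrite Rintegral_sum_sqr; last by move=> i; have [] := c1 i.
rewrite (_ : (fun k => _) =
    (fun k => \sum_i \int[mu]_(x in Q) (iter m./2 L (test_jet (f k)) [:: i] x ^+ 2))); last first.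
  apply/funext => k; apply: Rintegral_sum_sqr => i.
  by have [h _ _] := c1 i; exact: h.
elim: (index_enum _) => [|i r ih].
  rewrite big_nil (_ : (fun k => _) = fun=> 0); first exact: cvg_cst.
  by apply/funext => k; rewrite big_nil.
rewrite big_cons (_ : (fun k => _) = (fun k =>
  \int[mu]_(x in Q) (iter m./2 L (test_jet (f k)) [:: i] x ^+ 2) +
  \sum_(j <- r) \int[mu]_(x in Q) (iter m./2 L (test_jet (f k)) [:: j] x ^+ 2))).
  by apply: cvgD => //; exact: mean_square_cvg_norm.
by apply/funext => k; rewrite big_cons.
Qed.

End energy_limit.

(** * Every eigenvalue is at least (2m)! *)

Section eigenvalue_lower_bound.
Variables (R : realType) (n : nat).
Local Notation mu := (@lebesgue_measure_rV R n.+1).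
Local Notation Q := (@hypercube R n.+1).

Lemma energy_ge m (U : jet R n.+1) : Hm0 m U ->
  (2 * m)`!%:R * L2_dot U U <= energy m U U.
Proof.
move=> [HU [f tf fU]].
have fU2 s : (size s <= m)%N -> mean_square_cvg (fun k => partials s (f k)) (U s).
  move=> sm; split.
  - by move=> k; exact/square_integrable_test/test_function_partials.
  - by case: (HU s sm).
  - exact: fU.
have cE := energy_cvg fU2.
have cL : (fun k => (2 * m)`!%:R * \int[mu]_(x in Q) (f k x ^+ 2)) @ \oo --> (2 * m)`!%:R * L2_dot U U.
  by apply: cvgMl_tmp; exact: (mean_square_cvg_norm (fU2 [::] isT)).
rewrite -subr_ge0; apply: (cvgr_to_ge (cvgB cE cL)).
near=> k; rewrite subr_ge0.
exact: le_trans (partial0_norm_ge m (tf k)) (energy_test_ge ord0 m (tf k)).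
Unshelve. all: by end_near. Qed.

Lemma L2_dot_gt0 d (U : jet R d) : L2_dot U U != 0 -> 0 < L2_dot U U.
Proof.
rewrite lt_neqAle eq_sym => -> /=; apply: Rintegral_ge0 => x _.
by rewrite -expr2 sqr_ge0.
Qed.

Lemma dirichlet_eigenvalue_ge m (lam : R) : dirichlet_eigenvalue n.+1 m lam ->
  (2 * m)`!%:R <= lam.
Proof.
move=> [U [HU U0 eig]]; have := energy_ge HU.
by rewrite eig// ler_pM2r// L2_dot_gt0.
Qed.

End eigenvalue_lower_bound.

(** * Radial test functions *)

Section profile.
Variables (R : realType) (m : nat).
Implicit Types (t eps : R).

(* the smooth function t^(m - k) (eps / t)^b exp(- eps / t) of t, extended by
   zero; these functions span a space closed under differentiation *)
Definition profile eps k b t : R :=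
  if 0 < t then t ^+ m * t^-1 ^+ k * (eps * t^-1) ^+ b * expR (- (eps * t^-1)) else 0.

(** For n > 0, raise expR (w/n) >= w/n to the n-th power. *)
Lemma expr_expRN_le (w : R) n : 0 <= w -> w ^+ n * expR (- w) <= n%:R ^+ n.
Proof.
move=> w0; case: n => [|n].
  by rewrite !expr0 mul1r -[leRHS]expR0 ler_expR oppr_le0.
rewrite expRN ler_pdivrMr ?expR_gt0//.
have -> : w = n.+1%:R * (w / n.+1%:R) by rewrite mulrC divfK// pnatr_eq0.
rewrite expRM_natl exprMn ler_wpM2l ?exprn_ge0// lerXn2r ?nnegrE ?expR_ge0 ?divr_ge0//.
by apply: le_trans (expR_ge1Dx _); rewrite lerDr.
Qed.

(** The derivative is written with df / f rather than with the exponent n - 1; there is no case n =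
    0 to separate, and [field] can close the computation in [is_derive_profile]. *)
Lemma is_derive_expr (f : R -> R) t (df : R) n : f t != 0 -> is_derive t (1 : R) f df ->
  is_derive t (1 : R) (fun s => f s ^+ n) (n%:R * f t ^+ n * (df / f t)).
Proof.
move=> ft0 dft; elim: n => [|n ih].
  rewrite (_ : (fun x => _) = cst 1); last by apply/funext => y; rewrite expr0.
  by apply: is_derive_eq; rewrite !mul0r.
rewrite (_ : (fun x => _) = (f \* (fun x => f x ^+ n))); last first.
  by apply/funext => y; rewrite exprS.
apply: is_derive_eq; rewrite /GRing.scale/= !exprS -natr1; field.
by [].
Qed.

(** The exponential absorbs k + 2 powers of 1/t at the price of as many powers of 1/eps. The
    remaining t^(m+2) is at least quadratically small at 0 for every m. *)
Lemma profile_le eps k b t : 0 < eps -> 0 < t ->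
  `|profile eps k b t| <= (b + k.+2)%:R ^+ (b + k.+2) * eps^-1 ^+ k.+2 * t ^+ m.+2.
Proof.
move=> e0 t0; rewrite /profile t0.
have w0 : 0 <= eps * t^-1 by rewrite mulr_ge0 ?invr_ge0 ?ltW.
have y0 : 0 <= t^-1 by rewrite invr_ge0 ltW.
rewrite ger0_norm; last first.
  by rewrite mulr_ge0 ?expR_ge0// mulr_ge0 ?exprn_ge0// mulr_ge0 ?exprn_ge0// ltW.
have t_n0 : t != 0 by rewrite gt_eqF.
have yE : t^-1 = eps^-1 * (eps * t^-1) by rewrite mulKf// gt_eqF.
have -> : t ^+ m * t^-1 ^+ k * (eps * t^-1) ^+ b * expR (- (eps * t^-1)) =
    ((eps * t^-1) ^+ (b + k.+2) * expR (- (eps * t^-1))) * eps^-1 ^+ k.+2 * t ^+ m.+2.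
  have -> : t ^+ m * t^-1 ^+ k = t ^+ m.+2 * t^-1 ^+ k.+2.
    by rewrite !exprS; field.
  rewrite {1}yE exprMn exprD; ring.
apply: ler_wpM2r; first by rewrite exprn_ge0// ltW.
apply: ler_wpM2r; first by rewrite exprn_ge0// invr_ge0 ltW.
exact: expr_expRN_le.
Qed.

Lemma profile_npos eps k b t : t <= 0 -> profile eps k b t = 0.
Proof. by move=> t0; rewrite /profile ltNge t0. Qed.

Lemma is_derive_profile eps k b t : 0 < eps ->
  is_derive t (1 : R) (profile eps k b)
    ((m%:R - k%:R - b%:R) * profile eps k.+1 b t + profile eps k.+1 b.+1 t).
Proof.
move=> e0; have [t0|t0|t0] := ltgtP t 0.
- rewrite !profile_npos ?ltW// mulr0 addr0.
  apply: (near_eq_is_derive _ (is_derive_cst (0 : R) t 1)).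
  near=> s; rewrite profile_npos//; apply: ltW; near: s; exact: lt_nbhsl.
- pose g s := s ^+ m * s^-1 ^+ k * (eps * s^-1) ^+ b * expR (- (eps * s^-1)).
  have t_n0 : t != 0 by rewrite gt_eqF.
  have near_g : {near t, g =1 profile eps k b}.
    near=> s; rewrite /profile ifT//; near: s; exact: lt_nbhsr.
  apply: (near_eq_is_derive near_g).
  have dI : is_derive t (1 : R) (fun s => s) 1 by exact: is_derive_id.
  have dy : is_derive t (1 : R) (fun s => s^-1) (- (t ^- 2)).
    by apply: is_derive_eq; [exact: (is_deriveV t_n0 dI)|rewrite /GRing.scale/= mulr1].
  have dw : is_derive t (1 : R) (fun s => eps * s^-1) (- (eps * t ^- 2)).
    by apply: is_derive_eq; rewrite /GRing.scale/= mulrN.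
  have y_n0 : t^-1 != 0 by rewrite invr_eq0.
  have w_n0 : eps * t^-1 != 0 by rewrite mulf_neq0// gt_eqF.
  have d1 := is_derive_expr m t_n0 dI.
  have d2 := is_derive_expr k y_n0 dy.
  have d3 := @is_derive_expr (fun s => eps * s^-1) t _ b w_n0 dw.
  have d4 : is_derive t (1 : R) (fun s => expR (- (eps * s^-1)))
      (expR (- (eps * t^-1)) * (eps * t ^- 2)).
    have dN : is_derive t (1 : R) (fun s => - (eps * s^-1)) (eps * t ^- 2).
      by apply: is_derive_eq; rewrite opprK.
    exact: (@is_derive1_comp R expR (fun s => - (eps * s^-1)) t _ _ (is_derive_expR _) dN).
  apply: is_derive_eq; rewrite /profile t0 /GRing.scale/= !exprS.
  field.
  by rewrite t_n0 gt_eqF.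
(* At 0 the difference quotient is 0 from the left and, by [profile_le], at most C h from the right
   for 0 < h <= 1. *)
- rewrite t0 !profile_npos// mulr0 addr0.
  set C := (b + k.+2)%:R ^+ (b + k.+2) * eps^-1 ^+ k.+2.
  have C0 : 0 <= C by rewrite mulr_ge0 ?exprn_ge0 ?invr_ge0 ?ltW.
  have cv : (fun h : R => h^-1 *: ((profile eps k b \o shift 0) (h *: 1) - profile eps k b 0)) @ 0^' --> (0 : R).
    apply/cvgrPdist_le => e he.
    near=> h; rewrite /= addr0 [h *: 1]mulr1 [profile _ _ _ 0]profile_npos// subr0 sub0r normrN.
    have [h0|h0] := leP h 0; first by rewrite profile_npos// scaler0 normr0 ltW.
    have h1 : h <= 1 by apply: ltW; near: h; apply: nbhs_dnbhs; exact: lt_nbhsl.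
    rewrite normrZ normfV gtr0_norm// ler_pdivrMl//.
    apply: (le_trans (profile_le k b e0 h0)); rewrite -/C.
    have hm : h ^+ m.+2 <= h * h.
      by rewrite !exprS mulrA ler_piMr ?mulr_ge0 ?(ltW h0)// exprn_ile1// ltW.
    apply: (le_trans (ler_wpM2l C0 hm)); rewrite mulrCA; apply: ler_wpM2l; first exact: ltW.
    have he' : h <= e / (C + 1).
      apply: ltW; near: h; apply: nbhs_dnbhs; apply: lt_nbhsl.
      by rewrite divr_gt0// ltr_wpDl.
    apply: (le_trans (ler_wpM2l C0 he')); rewrite mulrA ler_pdivrMr ?ltr_wpDl//.
    by rewrite mulrC; apply: ler_wpM2l; rewrite ?lerDl// ltW.
  split; first by apply/cvg_ex; exists 0.
  exact: cvg_lim cv.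
Unshelve. all: by end_near. Qed.

End profile.

Section radial_functions.
Variables (R : realType) (d : nat).
Local Notation Rd := 'rV[R]_d.
Local Notation e_ i := (delta_mx ord0 i : Rd).
Implicit Types (f g : Rd -> R) (h : R -> R).

Lemma is_derive_coord (i j : 'I_d) (x : Rd) :
  is_derive x (e_ i) (fun y : Rd => y ord0 j) (i == j)%:R.
Proof.
have c : (fun k : R => k^-1 *: (((fun y : Rd => y ord0 j) \o shift x) (k *: e_ i) - x ord0 j)) @ 0^'
    --> ((i == j)%:R : R).
  apply: cvg_near_cst; near=> k.
  have k0 : k != 0 by near: k; exact: nbhs_dnbhs_neq.
  by rewrite /= !mxE eqxx /= addrK scalerA mulVf// scale1r eq_sym.
split; first by apply/cvg_ex; exists (i == j)%:R.
exact: cvg_lim c.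
Unshelve. all: by end_near. Qed.

Lemma smooth_coord (j : 'I_d) : smooth (fun x : Rd => x ord0 j).
Proof.
apply: (@generated_smooth R d (fun f => f = (fun x : Rd => x ord0 j) \/ exists c, f = fun=> c)).
  move=> f [->|[c ->]]; split.
  - exact: coord_continuous.
  - move=> i; split=> [x|]; first by have [] := is_derive_coord i j x.
    apply: generated_base; right; exists (i == j)%:R.
    by apply/funext => x; have [_ /= ->] := is_derive_coord i j x.
  - exact: cst_continuous.
  - move=> i; split=> [x|]; first exact: derivable_cst.
    apply: generated_base; right; exists 0.
    by apply/funext => x /=; rewrite derive_cst.
by apply: generated_base; left.
Qed.

Variable r : R.

Definition rho (x : Rd) : R := r - \sum_i x ord0 i ^+ 2.

Lemma smooth_rho : smooth rho.
Proof.
apply: smoothD; first exact: smooth_cst.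
rewrite (_ : (fun x => _) = fun x : Rd => (- 1) * \sum_i (x ord0 i * x ord0 i)); last first.
  by apply/funext => x; rewrite mulN1r; congr (- _); apply: eq_bigr => i _; rewrite expr2.
apply: smoothZ; apply: smooth_sum => i.
by apply: smoothM; exact: smooth_coord.
Qed.

Lemma is_derive_radial h h' i x : (forall t, is_derive t (1 : R) h (h' t)) ->
  is_derive x (e_ i) (fun y => h (rho y)) (h' (rho x) * (- 2 * x ord0 i)).
Proof.
(* Along the line x + s e_i the function rho is the quadratic polynomial p(s), so the one-variable
   chain rule suffices. *)
move=> dh; pose p (s : R) := rho x + (- 2 * x ord0 i * s - s ^+ 2).
have dp : is_derive (0 : R) (1 : R) p (- 2 * x ord0 i).
  by apply: is_derive_eq; rewrite /GRing.scale/=; ring.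
have p0 : p 0 = rho x by rewrite /p; ring.
have := @is_derive1_comp R h p 0 _ _ (dh (p 0)) dp.
rewrite p0 => -[ex_d d_eq].
have E : (fun k : R => k^-1 *: (((fun y => h (rho y)) \o shift x) (k *: e_ i) - h (rho x))) =
  (fun k : R => k^-1 *: (((h \o p) \o shift 0) (k *: (1 : R)) - (h \o p) 0)).
  apply/funext => k /=; rewrite p0; congr (_ *: (h _ - _)).
  rewrite addr0 [k *: 1]mulr1 /p /rho -!addrA; congr (_ + _).
  rewrite (bigD1 i)//= [X in _ = - X + _](bigD1 i)//= !mxE !eqxx.
  rewrite (eq_bigr (fun j => x ord0 j ^+ 2)); last first.
    by move=> j ji; rewrite !mxE (negbTE ji) andbF mulr0 add0r.
  by rewrite /=; ring.
by split; rewrite /derivable /derive E.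
Qed.

(** The gradient of rho has square 4 |x|^2 = 4 (r - rho) and its Laplacian is -2 d; hence the
    Laplacian acts on functions of rho as an ordinary differential operator. *)
Lemma lap_radial h h' h'' x : smooth (fun y => h (rho y)) ->
  (forall t, is_derive t (1 : R) h (h' t)) ->
  (forall t, is_derive t (1 : R) h' (h'' t)) ->
  lap (fun y => h (rho y)) x = 4 * (r - rho x) * h'' (rho x) - 2 * d%:R * h' (rho x).
Proof.
move=> sh dh dh'; rewrite /lap.
have E i : partials [:: i; i] (fun y => h (rho y)) x =
    h'' (rho x) * 4 * x ord0 i ^+ 2 - 2 * h' (rho x).
  have -> : partials [:: i; i] (fun y => h (rho y)) =
      partials [:: i] (fun y => h' (rho y) * (- 2 * y ord0 i)).
    congr (partials [:: i] _); apply/funext => y.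
    by have [_ /= ->] := is_derive_radial i y dh.
  have d1 := is_derive_radial i x dh'.
  have d2 := is_derive_coord i i x.
  have d3 : is_derive x (e_ i) (fun y : Rd => - 2 * y ord0 i) (- 2).
    by apply: is_derive_eq; rewrite /GRing.scale/= eqxx mulr1.
  have d4 : is_derive x (e_ i) (fun y => h' (rho y) * (- 2 * y ord0 i))
      (h'' (rho x) * 4 * x ord0 i ^+ 2 - 2 * h' (rho x)).
    by apply: is_derive_eq; rewrite /GRing.scale/=; ring.
  by have [_ /= ->] := d4.
under eq_bigr do rewrite E.
rewrite big_split/= -mulr_sumr sumr_const card_ord -mulr_natl /rho; ring.
Qed.

Lemma partialD i f g : smooth f -> smooth g ->
  partials [:: i] (f \+ g) = partials [:: i] f \+ partials [:: i] g.
Proof.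
by move=> sf sg; apply/funext => x; apply: deriveD; exact: smooth_derivable.
Qed.

Lemma partialZ i (c : R) f : smooth f ->
  partials [:: i] (fun x => c * f x) = fun x => c * partials [:: i] f x.
Proof.
by move=> sf; apply/funext => x; apply: deriveMl; exact: smooth_derivable.
Qed.

Lemma lapD f g : smooth f -> smooth g -> lap (f \+ g) = lap f \+ lap g.
Proof.
move=> sf sg; apply/funext => x; rewrite /lap /= -big_split; apply: eq_bigr => i _.
exact: (congr1 (@^~ x) (etrans (congr1 (partials [:: i]) (partialD i sf sg))
  (partialD i (smooth_partials [:: i] sf) (smooth_partials [:: i] sg)))).
Qed.

Lemma lapZ (c : R) f : smooth f -> lap (fun x => c * f x) = fun x => c * lap f x.
Proof.
move=> sf; apply/funext => x; rewrite /lap mulr_sumr; apply: eq_bigr => i _.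
exact: (congr1 (@^~ x) (etrans (congr1 (partials [:: i]) (partialZ i c sf))
  (partialZ i c (smooth_partials [:: i] sf)))).
Qed.

Variables (m : nat) (eps : R).
Hypothesis eps0 : 0 < eps.
Local Notation T k b := (profile m eps k b).

Let continuous_profile k b : continuous (T k b).
Proof.
move=> t; apply: differentiable_continuous; apply/derivable1_diffP.
by case: (is_derive_profile m k b t eps0).
Qed.

(** A partial derivative of a profile of rho is a combination of profiles times -2 x_i, so the
    generators are the profiles together with all smooth functions. *)
Lemma smooth_profile k b : smooth (fun x => T k b (rho x)).
Proof.
pose G f := smooth f \/ exists k b, f = fun x => T k b (rho x).
apply: (@generated_smooth R d G); last by apply: generated_base; right; exists k, b.
move=> f [sf|[{}k [{}b ->]]].
  split=> [|i]; first exact: smooth_continuous.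
  split=> [x|]; first exact: smooth_derivable.
  by apply: generated_base; left; exact: smooth_partials.
split=> [x|i].
  apply: (@continuous_comp _ _ _ rho); first exact: (smooth_continuous smooth_rho).
  exact: continuous_profile.
have dT x := is_derive_radial i x (fun t => is_derive_profile m k b t eps0).
split=> [x|]; first by have [] := dT x.
rewrite (_ : partials _ _ = (((fun x => m%:R - k%:R - b%:R) \* (fun x => T k.+1 b (rho x))) \+
    (fun x => T k.+1 b.+1 (rho x))) \* (fun x => - 2 * x ord0 i)); last first.
  by apply/funext => x; have [_ /= ->] := dT x.
have gT k' b' : generated G (fun x => T k' b' (rho x)).
  by apply: generated_base; right; exists k', b'.
apply: generated_mul; last first.
  by apply: generated_base; left; apply: smoothZ; exact: smooth_coord.
apply: generated_add => //; apply: generated_mul => //.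
by apply: generated_base; left; exact: smooth_cst.
Qed.

(** The support lies in the closed ball of squared radius r, which is inside the open cube because r
    < 1. *)
Lemma test_function_profile k b : 0 < r < 1 -> test_function (fun x => T k b (rho x)).
Proof.
move=> /andP[r0 r1]; split; first exact: smooth_profile.
exists [set x | 0 <= rho x]; split.
- apply: bounded_closed_compact.
    exists 1; split; first exact: num_real.
    move=> M M1 x /= x0; apply: (le_trans _ (ltW M1)).
    rewrite [`|x|]mx_normrE; apply: bigmax_le => // -[a i] _ /=; rewrite (ord1 a).
    rewrite -(@expr_le1 _ 2)// real_normK ?num_real//.
    move: x0; rewrite /rho subr_ge0 (bigD1 i)//= => /(le_trans _) h.
    apply: le_trans (ltW r1); apply: h; rewrite lerDl sumr_ge0// => j _; exact: sqr_ge0.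
  apply: (@preimage_closed _ _ rho [set t | 0 <= t]); last exact: closed_ge.
  by move=> x _; exact: (smooth_continuous smooth_rho).
- move=> x /= x0 i; rewrite -ltr_norml -(@expr_lt1 _ 2)// real_normK ?num_real//.
  move: x0; rewrite /rho subr_ge0 (bigD1 i)//= => /(le_trans _) h.
  by apply: le_lt_trans r1; apply: h; rewrite lerDl sumr_ge0// => j _; exact: sqr_ge0.
- by move=> x /negP; rewrite -ltNge => x0; apply: profile_npos; exact: ltW.
Qed.

Lemma profileMt k b t : t * T k.+1 b t = T k b t.
Proof.
rewrite /profile; case: ltP => t0; last by rewrite mulr0.
by rewrite exprS; field; rewrite gt_eqF.
Qed.

(* (c, k, b) stands for c * T k b *)
Definition combo := seq (R * nat * nat).

Definition eval_combo (L : combo) (t : R) : R :=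
  \sum_(q <- L) q.1.1 * T q.1.2 q.2 t.

(* the operator 4 (r - t) h'' - 2 d h' on combinations of profiles, using
   t * T k.+1 b = T k b *)
Definition lap_term (q : R * nat * nat) : combo :=
  let c := q.1.1 in let k := q.1.2 in let b := q.2 in
  let a : R := m%:R - k%:R - b%:R in
  [:: (4 * r * (a * (a - 1)) * c, k.+2, b);
      (4 * r * (2 * a - 2) * c, k.+2, b.+1);
      (4 * r * c, k.+2, b.+2);
      (- (4 * (a * (a - 1)) + 2 * d%:R * a) * c, k.+1, b);
      (- (4 * (2 * a - 2) + 2 * d%:R) * c, k.+1, b.+1);
      (- 4 * c, k.+1, b.+2)].

Definition lap_combo (L : combo) : combo := flatten [seq lap_term q | q <- L].

Lemma smooth_eval_combo L : smooth (fun x => eval_combo L (rho x)).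
Proof. by apply: smooth_sum => q; apply: smoothZ; exact: smooth_profile. Qed.

Lemma lap_profile k b x : lap (fun y => T k b (rho y)) x =
  eval_combo (lap_term (1, k, b)) (rho x).
Proof.
set a : R := m%:R - k%:R - b%:R.
have d1 t : is_derive t (1 : R) (T k b) (a * T k.+1 b t + T k.+1 b.+1 t).
  exact: is_derive_profile.
have d2 t : is_derive t (1 : R) (fun t => a * T k.+1 b t + T k.+1 b.+1 t)
    (a * (a - 1) * T k.+2 b t + (2 * a - 2) * T k.+2 b.+1 t + T k.+2 b.+2 t).
  have h1 := is_derive_profile m k.+1 b t eps0.
  have h2 := is_derive_profile m k.+1 b.+1 t eps0.
  by apply: is_derive_eq; rewrite /GRing.scale/= /a -!natr1; ring.
rewrite (lap_radial x (smooth_profile k b) d1 d2) /eval_combo /lap_term !big_cons big_nil /= -/a.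
have e1 := profileMt k.+1 b (rho x).
have e2 := profileMt k.+1 b.+1 (rho x).
have e3 := profileMt k.+1 b.+2 (rho x).
by rewrite -e1 -e2 -e3; ring.
Qed.

Lemma eval_combo_cat L1 L2 t : eval_combo (L1 ++ L2) t = eval_combo L1 t + eval_combo L2 t.
Proof. exact: big_cat. Qed.

Lemma lap_eval_combo L :
  lap (fun x => eval_combo L (rho x)) = fun x => eval_combo (lap_combo L) (rho x).
Proof.
elim: L => [|[[c k] b] L ih].
  rewrite (_ : (fun x => _) = fun x => 0 * (fun=> 0) x); last first.
    by apply/funext => x; rewrite /eval_combo big_nil mul0r.
  rewrite lapZ; last exact: smooth_cst.
  by apply/funext => x; rewrite !mul0r.
rewrite (_ : (fun x => _) =
    (fun x => c * T k b (rho x)) \+ (fun x => eval_combo L (rho x))); last first.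
  by apply/funext => x; rewrite /eval_combo big_cons.
rewrite lapD; [|by apply: smoothZ; exact: smooth_profile|exact: smooth_eval_combo].
rewrite ih lapZ; last exact: smooth_profile.
apply/funext => x; rewrite /= /lap_combo /= -/(lap_combo L) -cat1s.
rewrite [RHS](eval_combo_cat (lap_term (c, k, b))) lap_profile; congr (_ + _).
by rewrite /eval_combo /lap_term !big_cons !big_nil /=; ring.
Qed.

Lemma iter_lap_eval_combo j L : iter j (@lap R d) (fun x => eval_combo L (rho x)) =
  fun x => eval_combo (iter j lap_combo L) (rho x).
Proof. by elim: j => // j ih; rewrite !iterS ih lap_eval_combo. Qed.

End radial_functions.

(** * Iterated Laplacians as eps tends to 0 *)

Section combo_limit.
Variables (R : realType) (d : nat) (r : R) (m : nat).
Local Notation lap_term := (lap_term d r m).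
Local Notation lap_combo := (lap_combo d r m).
Implicit Types (L : combo R) (p : {poly R}).

(* A term with b = 0 and m < k survives as eps --> 0 but is ignored by
   combo_poly below; k <= 2 j keeps t^m t^(m - k) bounded when j = m. *)
Definition admissible j L := all (fun q : R * nat * nat =>
  (q.1.2 <= j.*2)%N && [|| q.2 != 0%N, (q.1.2 <= m)%N | q.1.1 == 0]) L.

(** For b = 0 the exponent is a = m - k, and the coefficients are multiples of a or of a (a - 1).
    They vanish exactly when a derivative would lead from a nonnegative power of t to a negative
    one, so no such term with b = 0 arises with a nonzero coefficient. *)
Lemma admissible_lap_combo j L : admissible j L -> admissible j.+1 (lap_combo L).
Proof.
elim: L => [//|[[c k] b] L ih] /andP[/andP[/= kj h] /ih {}ih].
rewrite -/(lap_combo L) ih !andbT doubleS !ltnS kj leqW //= !andbT.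
case: b h => [|b]; last by rewrite /= ?orbT.
rewrite /= subr0; case: (ltngtP k m) => [km _|mk|-> _].
- rewrite orTb andbT.
  move: km; rewrite leq_eqVlt => /predU1P[<-|->]; last by rewrite orTb.
  have -> : (k.+1%:R - k%:R - 1 : R) = 0 by rewrite -natr1; ring.
  by rewrite !(mulr0, mul0r) eqxx orbT.
- by move=> /eqP ->; rewrite !mulr0 !eqxx !orbT.
- by rewrite subrr !(mulr0, mul0r, add0r, oppr0) eqxx !orbT.
Qed.

(** The pointwise limit for t > 0 of an admissible combination: terms with b > 0 tend to 0, the
    others to powers of t. *)
Definition combo_poly L : {poly R} :=
  \sum_(q <- L | (q.2 == 0%N) && (q.1.2 <= m)%N) q.1.1 *: 'X^(m - q.1.2).

(** The operator of [lap_radial], acting on polynomials in t = rho. *)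
Definition poly_lap p : {poly R} :=
  (4 : R) *: ((r%:P - 'X) * p^`()^`()) - (2 * d%:R) *: p^`().

Lemma coef_poly_lap p i : (poly_lap p)`_i =
  4 * r * (i.+1 * i.+2)%:R * p`_i.+2 - (4 * (i * i.+1)%:R + 2 * d%:R * i.+1%:R) * p`_i.+1.
Proof.
rewrite /poly_lap coefB !coefZ mulrBl coefB coefCM coefXM !coef_deriv.
case: i => [|i] /=.
  by ring.
ring.
Qed.

Fact poly_lap_is_linear : linear poly_lap.
Proof.
move=> a p q; apply/polyP => i.
rewrite [RHS]coefD [X in _ = X + _]coefZ !coef_poly_lap !coefD !coefZ; ring.
Qed.

HB.instance Definition _ := GRing.isLinear.Build R {poly R} {poly R} _ poly_lap poly_lap_is_linear.

Lemma poly_lapXn n : poly_lap 'X^n =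
  (4 * r * (n%:R * (n%:R - 1))) *: 'X^(n.-2) - (4 * (n%:R * (n%:R - 1)) + 2 * d%:R * n%:R) *: 'X^(n.-1).
Proof.
apply/polyP => i; rewrite coef_poly_lap coefB !coefZ !coefXn.
case: n => [|[|n]] /=.
- by rewrite !(mul0r, mulr0, subr0, addr0).
- rewrite !eqSS; case: i => [|i]; rewrite /= ?(mulr0, mul0r, subr0, addr0, add0r, subrr)//.
rewrite !eqSS; have [->|_] := eqVneq i n.
  by rewrite ltn_eqF// !mulr0 !mulr1; ring.
have [->|_] := eqVneq i n.+1; last by rewrite !mulr0.
by rewrite !mulr0 !mulr1; ring.
Qed.

Lemma combo_poly_cat L1 L2 : combo_poly (L1 ++ L2) = combo_poly L1 + combo_poly L2.
Proof. exact: big_cat. Qed.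

Lemma combo_poly_lap_combo L : combo_poly (lap_combo L) = poly_lap (combo_poly L).
Proof.
elim: L => [|[[c k] b] L ih]; first by rewrite /combo_poly !big_nil linear0.
rewrite /lap_combo /= -/(lap_combo L) [LHS](combo_poly_cat (lap_term (c, k, b))) ih.
rewrite [combo_poly (_ :: L)](combo_poly_cat [:: (c, k, b)]) linearD; congr (_ + _).
rewrite /combo_poly /lap_term !big_cons !big_nil /=.
case: b => [|b] /=; last by rewrite linear0.
rewrite !addr0 subr0; case: (leqP k m) => km; last first.
  by rewrite !ltnNge (ltnW km) (leqW (ltnW km)) /= linear0.
rewrite linearZ /= poly_lapXn natrB// scalerBr !scalerA.
move: km; rewrite leq_eqVlt => /predU1P[->|km].
  by rewrite !ltnn subrr [(_.+2 <= _)%N]ltnNge leqnSn /= !(mul0r, mulr0, scale0r, addr0, subrr).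
rewrite km; case: (ltnP k.+1 m) => k1m.
  rewrite !subnS; congr (_ *: _ + _); first by rewrite mulrC.
  by rewrite -scaleNr; congr (_ *: _); ring.
have {k1m km} -> : m = k.+1 by apply/eqP; rewrite eqn_leq k1m km.
have -> : (k.+1%:R - k%:R : R) = 1 by rewrite -natr1; ring.
rewrite subSnn subnn subrr !(mulr0, mul0r, scale0r, add0r, addr0) -scaleNr.
by congr (_ *: _); ring.
Qed.

(** Each factor equals -2 (k + 1)(2 k + d), so up to the sign (-1)^m this is the constant product
    named in the overview. *)
Definition poly_lap_coef : R := \prod_(k < m) - (4 * (k * k.+1)%:R + 2 * d%:R * k.+1%:R).

(** The part of [poly_lap] containing r lowers the degree by two and the rest by one. After n steps
    only the leading coefficient, reduced by one degree each time, can contribute; the result does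
    not depend on r. *)
Lemma iter_poly_lap n p : (size p <= n.+1)%N -> iter n poly_lap p =
  (p`_n * \prod_(k < n) - (4 * (k * k.+1)%:R + 2 * d%:R * k.+1%:R))%:P.
Proof.
elim: n p => [|n ih] p sp; first by rewrite big_ord0 mulr1 [LHS]size1_polyC.
rewrite iterSr ih; last first.
  apply/leq_sizeP => i ni; rewrite coef_poly_lap.
  have si : (size p <= i.+1)%N by exact: leq_trans sp _.
  by rewrite [p`_i.+1]nth_default// [p`_i.+2]nth_default ?(leqW si)// !mulr0 subrr.
rewrite coef_poly_lap [p`_n.+2]nth_default// mulr0 sub0r big_ord_recr /=; congr _%:P.
ring.
Qed.

Lemma combo_poly_iter : combo_poly (iter m lap_combo [:: (1, 0%N, 0%N)]) = poly_lap_coef%:P.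
Proof.
have E j : combo_poly (iter j lap_combo [:: (1, 0%N, 0%N)]) = iter j poly_lap 'X^m.
  elim: j => [|j ih]; first by rewrite /combo_poly big_cons big_nil /= subn0 addr0 scale1r.
  by rewrite !iterS combo_poly_lap_combo ih.
by rewrite E iter_poly_lap ?size_polyXn// coefXn eqxx mul1r.
Qed.

Lemma admissible_iter j : admissible j (iter j lap_combo [:: (1, 0%N, 0%N)]).
Proof.
elim: j => [|j ih]; first by rewrite /admissible.
by rewrite iterS; exact: admissible_lap_combo.
Qed.

Lemma profile_mul_le (eps : R) k b t : 0 < eps -> 0 < t <= 1 -> (k <= m.*2)%N ->
  `|profile m eps 0 0 t * profile m eps k b t| <= b%:R ^+ b.
Proof.
move=> e0 /andP[t0 t1] km; rewrite /profile t0 !expr0 !mulr1.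
have w0 : 0 <= eps * t^-1 by rewrite mulr_ge0 ?invr_ge0 ?ltW.
have y0 : 0 <= t^-1 by rewrite invr_ge0 ltW.
rewrite ger0_norm; last first.
  by rewrite !mulr_ge0 ?expR_ge0 ?exprn_ge0// ltW.
have -> : t ^+ m * expR (- (eps * t^-1)) *
   (t ^+ m * t^-1 ^+ k * (eps * t^-1) ^+ b * expR (- (eps * t^-1))) =
   t ^+ (m.*2 - k) * expR (- (eps * t^-1)) * ((eps * t^-1) ^+ b * expR (- (eps * t^-1))).
  have -> : t ^+ (m.*2 - k) = t ^+ m * t ^+ m * t^-1 ^+ k.
    by rewrite -exprD addnn -{2}(subnK km) exprD -mulrA -exprMn mulfV ?gt_eqF// expr1n mulr1.
  ring.
apply: (le_trans _ (expr_expRN_le b w0)); rewrite ler_piMl//.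
  by rewrite mulr_ge0 ?exprn_ge0 ?expR_ge0.
rewrite mulr_ile1 ?exprn_ge0 ?expR_ge0 ?(ltW t0)//.
  by rewrite exprn_ile1// ltW.
by rewrite -expR0 ler_expR oppr_le0.
Qed.

(** M does not depend on eps: it is the dominating constant for the limit of the energies. *)
Lemma eval_combo_mul_le L : admissible m L -> exists2 M : R, 0 <= M &
  forall eps t : R, 0 < eps -> t <= 1 -> `|profile m eps 0 0 t * eval_combo m eps L t| <= M.
Proof.
elim: L => [|[[c k] b] L ih].
  by exists 0 => // eps t _ _; rewrite /eval_combo big_nil mulr0 normr0.
move=> /= /andP[/andP[/= km _] /ih[M M0 HM]].
exists (`|c| * b%:R ^+ b + M); first by rewrite addr_ge0// mulr_ge0// exprn_ge0.
move=> eps t e0 t1; rewrite /eval_combo big_cons /= mulrDr.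
apply: (le_trans (ler_normD _ _)); rewrite lerD//; last exact: HM.
have [t0|t0] := leP t 0; first by rewrite profile_npos// mul0r normr0 mulr_ge0 ?exprn_ge0.
by rewrite mulrCA normrM ler_wpM2l// profile_mul_le// t0.
Qed.

Lemma profile_cvg k b (t : R) : 0 < t ->
  (fun n : nat => profile m n.+1%:R^-1 k b t) @ \oo --> (if b == 0%N then t ^+ m * t^-1 ^+ k else 0).
Proof.
move=> t0; rewrite /profile t0.
have w0 : (fun n : nat => n.+1%:R^-1 * t^-1) @ \oo --> (0 : R).
  by rewrite -[X in _ --> X](mul0r t^-1); apply: cvgMr_tmp; exact: cvg_harmonic.
have c1 : (fun n : nat => (n.+1%:R^-1 * t^-1) ^+ b) @ \oo --> (0 : R) ^+ b.
  exact: (cvg_comp _ _ w0 (@exprn_continuous _ b 0)).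
have c2 : (fun n : nat => expR (- (n.+1%:R^-1 * t^-1))) @ \oo --> expR (- 0 : R).
  by apply: (cvg_comp _ _ (cvgN w0)); exact: continuous_expR.
have : (fun n : nat => t ^+ m * t^-1 ^+ k * (n.+1%:R^-1 * t^-1) ^+ b * expR (- (n.+1%:R^-1 * t^-1)))
    @ \oo --> t ^+ m * t^-1 ^+ k * 0 ^+ b * expR (- 0).
  by apply: cvgM => //; exact: cvgMl_tmp.
by rewrite oppr0 expR0 mulr1; case: b {c1} => [|b] /=; rewrite ?expr0 ?mulr1 ?expr0n ?mulr0.
Qed.

Lemma eval_combo_cvg j L (t : R) : 0 < t -> admissible j L ->
  (fun n : nat => eval_combo m n.+1%:R^-1 L t) @ \oo --> (combo_poly L).[t].
Proof.
move=> t0; elim: L => [|[[c k] b] L ih] /=.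
  rewrite /combo_poly big_nil horner0 (_ : (fun n => _) = fun=> 0); first by move=> _; exact: cvg_cst.
  by apply/funext => n; rewrite /eval_combo big_nil.
move=> /andP[/andP[_ /= h] /ih {}ih].
have : (fun n : nat => c * profile m n.+1%:R^-1 k b t + eval_combo m n.+1%:R^-1 L t) @ \oo -->
    c * (if b == 0%N then t ^+ m * t^-1 ^+ k else 0) + (combo_poly L).[t].
  by apply: cvgD => //; apply: cvgMl_tmp; exact: profile_cvg.
rewrite /combo_poly big_cons /= -/(combo_poly L).
rewrite (_ : (fun n => eval_combo _ _ (_ :: _) _) = (fun n : nat => c * profile m n.+1%:R^-1 k b t) \+
  (fun n => eval_combo m n.+1%:R^-1 L t)); last first.
  by apply/funext => n; rewrite /eval_combo big_cons.
case: b h => [|b] /=; last by rewrite mulr0 add0r.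
case: (leqP k m) => [km _|km /= /eqP ->]; last by rewrite mul0r add0r.
rewrite hornerD hornerZ hornerXn.
have -> // : t ^+ (m - k) = t ^+ m * t^-1 ^+ k.
by rewrite -{2}(subnK km) exprD -mulrA -exprMn mulfV ?gt_eqF// expr1n mulr1.
Qed.

End combo_limit.

(** * The upper bound *)

Section upper_bound.
Variables (R : realType) (d m : nat) (r a rho0 : R).
Hypotheses (r01 : 0 < r < 1) (a01 : 0 < a < 1) (rho0_gt0 : 0 < rho0).
Hypothesis rho0_le : rho0 + d%:R * a ^+ 2 <= r.
Local Notation Rd := 'rV[R]_d.
Local Notation mu := (@lebesgue_measure_rV R d).
Local Notation Q := (@hypercube R d).

Let mQ : measurable Q := @measurable_hypercube R d.

Let f (k : nat) (x : Rd) : R := profile m k.+1%:R^-1 0 0 (rho r x).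

Let invS_gt0 k : 0 < k.+1%:R^-1 :> R. Proof. by rewrite invr_gt0. Qed.

Let tf k : test_function (f k).
Proof. exact: test_function_profile (invS_gt0 k) 0 0 r01. Qed.

Let combo_m := iter m (lap_combo d r m) [:: (1, 0%N, 0%N)].

Let iter_lap_f k : iter m (@lap R d) (f k) = fun x => eval_combo m k.+1%:R^-1 combo_m (rho r x).
Proof.
rewrite -(@iter_lap_eval_combo R d r m _ (invS_gt0 k)); congr (iter _ _ _).
by apply/funext => x; rewrite /eval_combo big_cons big_nil mul1r addr0.
Qed.

Let rho_le1 (x : Rd) : rho r x <= 1.
Proof.
have /andP[_ r1] := r01; apply: le_trans (ltW r1).
by rewrite /rho lerBlDr lerDl sumr_ge0// => i _; exact: sqr_ge0.
Qed.

Let K := poly_lap_coef R d m.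

Let G (x : Rd) : R := if 0 < rho r x then rho r x ^+ m * K else 0.

Let g k x := f k x * iter m (@lap R d) (f k) x.

Let g_cvg x : (g ^~ x) @ \oo --> G x.
Proof.
rewrite /G; case: ifPn => [rx|]; last first.
  rewrite -leNgt => rx; rewrite (_ : (fun k => _) = fun=> 0); first exact: cvg_cst.
  by apply/funext => k; rewrite /g /f profile_npos// mul0r.
rewrite (_ : (fun k => _) = fun k : nat => profile m k.+1%:R^-1 0 0 (rho r x) *
    eval_combo m k.+1%:R^-1 combo_m (rho r x)); last first.
  by apply/funext => k; rewrite /g iter_lap_f.
apply: cvgM.
  by have := @profile_cvg R m 0 0 _ rx; rewrite eqxx expr0 mulr1.
have := eval_combo_cvg rx (admissible_iter d r m m).
by rewrite combo_poly_iter hornerC.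
Qed.

Let measurable_g k : measurable_fun Q (g k).
Proof.
apply: measurable_funTS; apply: continuous_measurable_rV; apply: smooth_continuous.
apply: smoothM; [by have [] := tf k|].
by have [] := test_function_iter_lap m (tf k).
Qed.

Let energy_f k : energy m (test_jet (f k)) (test_jet (f k)) = (-1) ^+ m * \int[mu]_(x in Q) g k x.
Proof. exact: energy_test_lap (tf k). Qed.

Let energy_f_cvg :
  (fun k => energy m (test_jet (f k)) (test_jet (f k))) @ \oo -->
  (-1) ^+ m * \int[mu]_(x in Q) G x.
Proof.
rewrite (_ : (fun k => _) = fun k => (-1) ^+ m * \int[mu]_(x in Q) g k x); last first.
  by apply/funext => k; exact: energy_f.
apply: cvgMl_tmp.
have [M M0 HM] := eval_combo_mul_le (admissible_iter d r m m).
have mg k : measurable_fun Q (EFin \o g k) by exact/measurable_EFinP.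
have mG : measurable_fun Q (EFin \o G).
  apply/measurable_EFinP; apply: (measurable_fun_cvg (h := g)) => // x _; exact: g_cvg.
have gM k x : `|g k x| <= M by rewrite /g iter_lap_f HM.
have iM : mu.-integrable Q (EFin \o cst M).
  by apply: (bounded_integrable_hypercube (M := M)) => // x _; rewrite /= ger0_norm.
have [||iG _ c] := @dominated_convergence _ _ _ mu Q mQ (fun k => EFin \o g k) (EFin \o G) (EFin \o cst M) mg mG _ iM _.
- by apply: aeW => x _; apply: cvg_EFin; [exact: nearW|exact: g_cvg].
- by apply: aeW => x k _; rewrite /= lee_fin.
rewrite /Rintegral; apply: fine_cvg.
by rewrite fineK//; exact: integrable_fin_num.
Qed.

Let G_le x : `|G x| <= `|K|.
Proof.
rewrite /G; case: ifPn => [rx|_]; last by rewrite normr0.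
rewrite normrM ler_piMl// normrX gtr0_norm// exprn_ile1//; exact: ltW.
Qed.

Let integral_G_le : (-1) ^+ m * \int[mu]_(x in Q) G x <= `|K| * 2 ^+ d.
Proof.
have mG : measurable_fun Q G.
  by apply: (measurable_fun_cvg (h := g)) => // x _; exact: g_cvg.
have iG : mu.-integrable Q (EFin \o G).
  by apply: (bounded_integrable_hypercube (M := `|K|)) => // x _; exact: G_le.
have iK : mu.-integrable Q (EFin \o cst `|K|).
  by apply: (bounded_integrable_hypercube (M := `|K|)) => // x _; rewrite /= normr_id.
apply: le_trans (ler_norm _) _; rewrite normrM normrX normrN1 expr1n mul1r.
apply: (le_trans (le_normr_Rintegral mQ iG)).
apply: (@le_trans _ _ (\int[mu]_(x in Q) `|K|)).
  by apply: le_Rintegral => //; exact: integrable_norm.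
rewrite Rintegral_cst// ler_wpM2l//.
have -> : (2 : R) ^+ d = fine ((2 * 1) ^+ d)%:E by rewrite mulr1.
rewrite -lebesgue_measure_rV_closed_box// fine_le//.
- by rewrite ge0_fin_numE// hypercube_finite.
- by rewrite lebesgue_measure_rV_closed_box.
- apply: le_measure; rewrite ?inE//; first exact: measurable_closed_box.
  exact: hypercube_closed_box.
Qed.

Let box_rho (x : Rd) : closed_box a x -> rho0 <= rho r x.
Proof.
move=> xa; rewrite /rho lerBrDr; apply: le_trans rho0_le; rewrite lerD2l.
apply: (@le_trans _ _ (\sum_(i < d) a ^+ 2)).
  apply: ler_sum => i _; have := xa i; rewrite in_itv/= -ler_norml => xi.
  by rewrite -(@real_normK _ (x ord0 i)) ?num_real// lerXn2r// nnegrE; case/andP: a01 => /ltW.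
by rewrite sumr_const card_ord mulr_natl.
Qed.

(** On the box of half-side a one has rho >= rho0, and t^m exp(-eps/t) increases with t; the box has
    volume (2 a)^d. *)
Let norm_f_ge k : (rho0 ^+ m * expR (- (k.+1%:R^-1 * rho0^-1))) ^+ 2 * (2 * a) ^+ d <=
  L2_dot (test_jet (f k)) (test_jet (f k)).
Proof.
have /andP[a0 a1] := a01.
have mB := @measurable_closed_box R d a.
have BQ : closed_box a `<=` Q.
  move=> x xa i; have := xa i; rewrite in_itv/= => /andP[h1 h2]; apply/andP; split; lra.
set c := _ ^+ 2.
have muB : fine (mu (closed_box a)) = (2 * a) ^+ d.
  by rewrite lebesgue_measure_rV_closed_box// ltW.
have c0 : 0 <= c by exact: sqr_ge0.
rewrite /L2_dot -muB -lee_fin.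
have [sf _] := tf k.
have iff : mu.-integrable Q (EFin \o (fun x => f k x * f k x)).
  exact: (test_function_integrable (test_functionMr (tf k) sf)).
rewrite [leRHS](_ : _ = \int[mu]_(x in Q) (f k x * f k x)%:E)%E; last first.
  by rewrite /Rintegral fineK//; exact: integrable_fin_num.
rewrite EFinM fineK; last by rewrite lebesgue_measure_rV_closed_box// ltW.
rewrite -integral_cst//.
apply: (@le_trans _ _ (\int[mu]_(x in closed_box a) (f k x * f k x)%:E)%E); last first.
  apply: ge0_subset_integral => //; first by case/integrableP: iff.
  by move=> x _; rewrite lee_fin -expr2 sqr_ge0.
apply: ge0_le_integral => //.
- apply: measurable_funTS; apply/measurable_EFinP; apply: continuous_measurable_rV.
  exact: (smooth_continuous (smoothM sf sf)).
- move=> x /box_rho xr; rewrite lee_fin -expr2 /c.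
  have rx : 0 < rho r x by exact: lt_le_trans xr.
  have f_ge : rho0 ^+ m * expR (- (k.+1%:R^-1 * rho0^-1)) <= f k x.
    rewrite /f /profile rx !expr0 !mulr1.
    apply: ler_pM; rewrite ?expR_ge0 ?exprn_ge0 ?(ltW rho0_gt0)//.
      by rewrite lerXn2r ?nnegrE ?(ltW rho0_gt0) ?(ltW rx).
    by rewrite ler_expR lerN2 ler_wpM2l ?(ltW (invS_gt0 k))// lef_pV2.
  have p0 : 0 <= rho0 ^+ m * expR (- (k.+1%:R^-1 * rho0^-1)).
    by rewrite mulr_ge0 ?expR_ge0// exprn_ge0// ltW.
  by rewrite lerXn2r ?nnegrE// (le_trans p0).
Qed.

Lemma first_eigenvalue_le lam : first_dirichlet_eigenvalue d m lam -> 0 <= lam ->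
  lam * ((rho0 ^+ m) ^+ 2 * (2 * a) ^+ d) <= `|poly_lap_coef R d m| * 2 ^+ d.
Proof.
move=> [_ lam_min] lam0.
have /andP[a0 a1] := a01.
pose e k := expR (- (k.+1%:R^-1 * rho0^-1)) : R.
have key k : lam * ((rho0 ^+ m * e k) ^+ 2 * (2 * a) ^+ d) <=
    energy m (test_jet (f k)) (test_jet (f k)).
  apply: (le_trans (ler_wpM2l lam0 (norm_f_ge k))).
  have L0 : 0 < L2_dot (test_jet (f k)) (test_jet (f k)).
    apply: lt_le_trans (norm_f_ge k).
    by rewrite mulr_gt0 ?exprn_gt0 ?mulr_gt0 ?expR_gt0 ?exprn_gt0.
  by rewrite -ler_pdivlMr//; apply: lam_min; [exact: Hm0_test|rewrite gt_eqF].
apply: le_trans integral_G_le.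
have ce : (fun k => e k) @ \oo --> (1 : R).
  have w0 : (fun k : nat => k.+1%:R^-1 * rho0^-1) @ \oo --> (0 : R).
    by rewrite -[X in _ --> X](mul0r rho0^-1); apply: cvgMr_tmp; exact: cvg_harmonic.
  have : e @ \oo --> expR (- 0 : R).
    by apply: (cvg_comp _ _ (cvgN w0)); exact: continuous_expR.
  by rewrite oppr0 expR0.
have c1 : (fun k => lam * ((rho0 ^+ m * e k) ^+ 2 * (2 * a) ^+ d)) @ \oo -->
    lam * ((rho0 ^+ m) ^+ 2 * (2 * a) ^+ d).
  have c2 : (fun k => rho0 ^+ m * e k) @ \oo --> rho0 ^+ m.
    by rewrite -[X in _ --> X]mulr1; apply: cvgMl_tmp.
  by apply: cvgMl_tmp; apply: cvgMr_tmp; exact: (cvgM c2 c2).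
rewrite -subr_ge0; apply: (cvgr_to_ge (cvgB energy_f_cvg c1)).
by apply: nearW => k; rewrite subr_ge0; exact: key.
Qed.

End upper_bound.

(** * Asymptotics *)

Section factorial_estimates.
Variable R : realType.

Lemma ln_ge_subV (x : R) : 0 < x -> 1 - x^-1 <= ln x.
Proof.
move=> x0; have h : -1 < x^-1 - 1 by rewrite ltrBrDl subrr invr_gt0.
by have := le_ln1Dx h; rewrite addrC subrK lnV ?posrE//; lra.
Qed.

Lemma ln_succ (n : nat) : (0 < n)%N ->
  n.+1%:R^-1 <= ln (n.+1%:R : R) - ln (n%:R : R) <= n%:R^-1.
Proof.
move=> n0; have n0' : (0 : R) < n%:R by rewrite ltr0n.
rewrite -ln_div ?posrE//; apply/andP; split.
  apply: le_trans (ln_ge_subV _); last by rewrite divr_gt0.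
  by rewrite invf_div -natr1 le_eqVlt; apply/orP; left; apply/eqP; field; rewrite natr1 pnatr_eq0.
have -> : (n.+1%:R / n%:R : R) = 1 + n%:R^-1.
  by rewrite -natr1; field; rewrite gt_eqF.
by apply: le_ln1Dx; apply: lt_trans (_ : 0 < _); rewrite ?ltrN10 ?invr_gt0.
Qed.

(** Together with [ln_fact_le] this is Stirling's formula up to O(ln n), obtained by summing
    [ln_succ]. The present side has no logarithmic error. *)
Lemma ln_fact_ge (n : nat) : (0 < n)%N ->
  n%:R * ln (n%:R : R) - n%:R <= ln (n`!%:R : R).
Proof.
elim: n => // -[_ _|n /(_ isT) ih _].
  by rewrite (_ : 1`! = 1%N)// !ln1 mulr0 sub0r oppr_le0.
have /andP[_] := @ln_succ n.+1 isT.
rewrite -(@ler_pM2l _ n.+1%:R)// mulfV ?pnatr_eq0// => h.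
rewrite factS natrM lnM ?posrE ?ltr0n ?fact_gt0//.
rewrite -[n.+2%:R as X in X * _]natr1 -[n.+2%:R as X in _ - X]natr1; lra.
Qed.

Lemma ln_fact_le (n : nat) : (0 < n)%N ->
  ln (n`!%:R : R) <= (n%:R + 1) * ln (n%:R : R) - n%:R + 1.
Proof.
elim: n => // -[_ _|n /(_ isT) ih _].
  by rewrite (_ : 1`! = 1%N)// !ln1 mulr0; lra.
have /andP[+ _] := @ln_succ n.+1 isT.
rewrite -(@ler_pM2l _ n.+2%:R)// mulfV ?pnatr_eq0// => h.
rewrite factS natrM lnM ?posrE ?ltr0n ?fact_gt0//.
move: h ih; move: (ln (n.+2%:R : R)) (ln (n.+1%:R : R)) (ln _) => u v w.
rewrite -[n.+2%:R]natr1; move: (n.+1%:R : R) => N; lra.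
Qed.

Lemma bernoulli_ge (x : R) n : 0 <= x <= 1 -> 1 - n%:R * x <= (1 - x) ^+ n.
Proof.
move=> /andP[x0 x1]; elim: n => [|n ih]; first by rewrite mul0r subr0 expr0.
rewrite exprS -natr1; have := ler_wpM2l (_ : 0 <= 1 - x) ih.
rewrite subr_ge0 x1 => /(_ isT); have := mulr_ge0 (ler0n R n) (sqr_ge0 x).
move: (n%:R) ((1 - x) ^+ n) => u v; nra.
Qed.

End factorial_estimates.

(** * Explicit upper bound for the first eigenvalue *)

Section eigenvalue_bounds.
Variables (R : realType) (n : nat).
Local Notation d := n.+1.

(** Each factor is at most 4 (k + 1)(k + 1 + d), which gives 4^m m! (m + d)!; passing from (m + d)!
    to m! costs only (m + d)^d. *)
Lemma normr_poly_lap_coef_le m :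
  `|poly_lap_coef R d m| <= (4 ^ m * m`! * (m`! * (m + d) ^ d))%:R.
Proof.
have fact_le k : ((m + k)`! <= m`! * (m + k) ^ k)%N.
  elim: k => [|k ih]; first by rewrite addn0 expn0 muln1.
  rewrite addnS factS expnS mulnCA leq_mul2l /=; apply: (leq_trans ih).
  by apply: leq_mul => //; case: k {ih} => // k; rewrite leq_exp2r.
apply: (@le_trans _ _ (4 ^ m * m`! * (m + d)`!)%:R); last by rewrite ler_nat leq_mul2l fact_le orbT.
rewrite /poly_lap_coef; elim: m {fact_le} => [|m ih].
  by rewrite big_ord0 normr1 ler1n muln1 add0n expn0 mul1n fact_gt0.
rewrite big_ord_recr /= normrM.
have -> : (4 ^ m.+1 * (m.+1)`! * (m.+1 + d)`! = (4 ^ m * m`! * (m + d)`!) * (4 * m.+1 * (m.+1 + d)))%N.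
  by rewrite addSn !factS expnS; ring.
rewrite [leRHS]natrM ler_pM// normrN -!natrM -natrD ger0_norm// ler_nat; nia.
Qed.

Lemma first_eigenvalue_nat_le m lam : first_dirichlet_eigenvalue d m lam ->
  (4 * d.+1 <= m)%N ->
  lam <= (2 * m ^ d)%:R * (4 ^ m * m`! * (m`! * (2 * m) ^ d))%:R :> R.
Proof.
move=> hlam md; have [eig _] := hlam.
have lam0 : 0 <= lam by apply: le_trans (dirichlet_eigenvalue_ge eig); exact: ler0n.
have m1 : (1 < m)%N by apply: leq_trans md; rewrite mulnS.
have m0 : (0 : R) < m%:R by rewrite ltr0n ltnW.
(* With r = 1 - m^(-2), a = 1/m and rho0 = 1 - (d + 1) m^(-2), Bernoulli gives rho0^(2m) >= 1 - 2 (d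
   + 1)/m >= 1/2 once m >= 4 (d + 1). The small box costs only the factor m^d. *)
pose x : R := m%:R^-1 ^+ 2.
have x0 : 0 < x by rewrite exprn_gt0 ?invr_gt0.
have mx : m%:R * x = m%:R^-1 by rewrite /x expr2 mulrA mulfV ?mul1r// gt_eqF.
have dx : d.+1%:R * m%:R^-1 <= 1 / 4 :> R.
  rewrite ler_pdivrMr// mul1r mulrC ler_pdivlMr// -natrM ler_nat mulnC//.
have minv1 : m%:R^-1 < 1 :> R by rewrite invf_lt1// ltr1n.
have minv0 : 0 < m%:R^-1 :> R by rewrite invr_gt0.
have x1 : x <= m%:R^-1 by rewrite /x expr2 ler_piMr// ltW.
have d1x : d.+1%:R * x <= 1 / 4.
  by apply: le_trans dx; rewrite ler_wpM2l.
have rho0_gt0 : 0 < 1 - d.+1%:R * x by lra.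
have r01 : 0 < 1 - x < 1 by apply/andP; split; lra.
have a01 : 0 < (m%:R^-1 : R) < 1 by rewrite minv0.
have rho0_le : 1 - d.+1%:R * x + d%:R * m%:R^-1 ^+ 2 <= 1 - x.
  by rewrite -/x -natr1; lra.
have := first_eigenvalue_le r01 a01 rho0_gt0 rho0_le hlam lam0.
rewrite -exprM => h.
have half : 1 / 2 <= (1 - d.+1%:R * x) ^+ (m * 2).
  apply: le_trans (bernoulli_ge _ _); last first.
    by rewrite mulr_ge0 ?(ltW x0)//=; lra.
  have -> : (m * 2)%:R * (d.+1%:R * x) = 2 * (d.+1%:R * (m%:R * x)) by rewrite natrM; ring.
  by rewrite mx; lra.
have aE : (2 * m%:R^-1) ^+ d = 2 ^+ d / m%:R ^+ d :> R by rewrite exprMn exprVn.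
have md0 : 0 < m%:R ^+ d :> R by rewrite exprn_gt0.
have d20 : 0 < 2 ^+ d :> R by rewrite exprn_gt0.
have {h half} : lam * (1 / 2 * (2 ^+ d / m%:R ^+ d)) <= `|poly_lap_coef R d m| * 2 ^+ d.
  apply: le_trans h; rewrite aE ler_wpM2l// ler_wpM2r// divr_ge0// ltW//.
have -> : lam * (1 / 2 * (2 ^+ d / m%:R ^+ d)) = lam / (2 * m%:R ^+ d) * 2 ^+ d.
  by field; rewrite gt_eqF.
rewrite ler_pM2r// ler_pdivrMr ?mulr_gt0// => h; apply: (le_trans h).
rewrite mulrC natrM natrX ler_wpM2l ?mulr_ge0 ?exprn_ge0//.
apply: (le_trans (normr_poly_lap_coef_le m)); rewrite ler_nat.
have mdm : (m + d <= 2 * m)%N by move: md; clear; lia.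
by rewrite !leq_mul// leq_exp2r.
Qed.

End eigenvalue_bounds.

Section asymptotics.
Variable R : realType.

(** From exp(-s) >= 1 - s, since (1 - s)(1 + 2 s) >= 1 on this interval. *)
Lemma expR_le_1D2x (s : R) : 0 <= s <= 1 / 2 -> expR s <= 1 + 2 * s.
Proof.
move=> /andP[s0 s1]; have := expR_ge1Dx (- s).
have e0 := expR_gt0 s; rewrite expRN -(ler_pM2r e0) mulVf ?gt_eqF// => h.
move: (expR s) e0 h => E; nra.
Qed.

Lemma ln_le_sqrt (x : R) : 0 < x -> ln x <= 2 * Num.sqrt x.
Proof.
move=> x0; have s0 : 0 < Num.sqrt x by rewrite sqrtr_gt0.
rewrite -{1}(sqr_sqrtr (ltW x0)) lnXn// -[leLHS]mulr_natl ler_wpM2l//.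
have h : -1 < Num.sqrt x - 1 by lra.
by have := le_ln1Dx h; rewrite addrC subrK => /le_trans; apply; lra.
Qed.

Lemma powR_root (lam : R) m : 0 < lam -> lam `^ (1 / (2 * m)%:R) = expR (ln lam / (2 * m)%:R).
Proof. by move=> l0; rewrite /powR gt_eqF// mul1r mulrC. Qed.

Lemma root_factorial_ge m (lam : R) : (0 < m)%N -> (2 * m)`!%:R <= lam ->
  (2 * m)%:R / expR 1 <= lam `^ (1 / (2 * m)%:R).
Proof.
move=> m0 lam_ge.
have m20 : (0 < 2 * m)%N by rewrite muln_gt0.
have f0 : 0 < (2 * m)`!%:R :> R by rewrite ltr0n fact_gt0.
have l0 : 0 < lam := lt_le_trans f0 lam_ge.
have m2r : 0 < (2 * m)%:R :> R by rewrite ltr0n.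
rewrite powR_root// -expRN -{1}(lnK (_ : (2 * m)%:R \is Num.pos)) ?posrE// -expRD ler_expR.
rewrite ler_pdivlMr// mulrDl mulN1r mulrC.
apply: le_trans (ln_fact_ge R m20) _.
by rewrite ler_ln ?posrE.
Qed.

(** The root is at most (2m/e) e^s with s = C ln m / (2m). The condition 4 C^2 <= m and ln m <= 2
    sqrt m give C ln m <= m, so s <= 1/2 and e^s <= 1 + 2 s; the excess is (2/e) C ln m <= C ln
    m. *)
Lemma root_le_of_poly_bound m (lam C : R) : (1 < m)%N -> 0 < lam -> 0 <= C ->
  4 * C ^+ 2 <= m%:R ->
  ln lam <= 2 * m%:R * (ln (2 * m)%:R - 1) + C * ln m%:R ->
  lam `^ (1 / (2 * m)%:R) <= (2 * m)%:R / expR 1 + C * ln m%:R.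
Proof.
move=> m1 l0 C0 Cm lnl.
have m0 : 0 < m%:R :> R by rewrite ltr0n ltnW.
have m2r : 0 < (2 * m)%:R :> R by rewrite natrM mulr_gt0.
have lnm0 : 0 <= ln (m%:R : R) by rewrite ln_ge0// ler1n ltnW.
pose s := C * ln (m%:R : R) / (2 * m)%:R.
have s0 : 0 <= s by rewrite divr_ge0// mulr_ge0.
have Clnm : C * ln (m%:R : R) <= m%:R.
  have q0 : 0 <= Num.sqrt (m%:R : R) := sqrtr_ge0 _.
  have qm : Num.sqrt (m%:R : R) ^+ 2 = m%:R by rewrite sqr_sqrtr// ltW.
  have Cq : 2 * C <= Num.sqrt (m%:R : R).
    rewrite -(@ler_pXn2r _ 2) ?nnegrE ?mulr_ge0// qm; apply: le_trans Cm.
    by rewrite exprMn -natrX.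
  apply: le_trans (ler_wpM2l C0 (ln_le_sqrt m0)) _.
  by rewrite mulrCA mulrA -[leRHS]qm expr2 ler_wpM2r.
have s1 : s <= 1 / 2.
  by rewrite /s natrM ler_pdivrMr ?mulr_gt0//; move: Clnm; lra.
rewrite powR_root//.
have : ln lam / (2 * m)%:R <= ln (2 * m)%:R + (-1 + s).
  rewrite ler_pdivrMr// !mulrDl /s divfK ?gt_eqF//.
  by apply: le_trans lnl _; rewrite natrM; lra.
rewrite -ler_expR => /le_trans; apply.
rewrite expRD lnK ?posrE// expRD expRN mulrA.
have e2 : 2 <= expR 1 :> R by have := @expR_ge1Dx R 1.
have e0 : 0 < expR 1 :> R := expR_gt0 _.
have k0 : 0 <= (2 * m)%:R / expR 1 :> R by rewrite divr_ge0// ltW.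
apply: le_trans (ler_wpM2l k0 (expR_le_1D2x _)) _; first by rewrite s0.
rewrite mulrDr mulr1 lerD2l.
have -> : (2 * m)%:R / expR 1 * (2 * s) = (2 / expR 1) * (C * ln (m%:R : R)).
  by rewrite /s; field; rewrite gt_eqF// gt_eqF.
by rewrite ler_piMl ?mulr_ge0// ler_pdivrMr// mul1r.
Qed.

(** The 3 d collects two powers m^d and one 2^d. The 7 collects ln 2 <= ln m, the 2 ln m from the
    two factorials, and their additive constant 2 <= 4 ln 2 <= 4 ln m. *)
Lemma ln_poly_bound (d m : nat) : (1 < m)%N ->
  ln ((2 * m ^ d)%:R * (4 ^ m * m`! * (m`! * (2 * m) ^ d))%:R : R) <=
  2 * m%:R * (ln ((2 * m)%:R : R) - 1) + (3 * d + 7)%:R * ln (m%:R : R).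
Proof.
move=> m1; have m0 : 0 < m%:R :> R by rewrite ltr0n ltnW.
have f0 : 0 < (m`!)%:R :> R by rewrite ltr0n fact_gt0.
have fle := ln_fact_le R (ltnW m1).
have l2 : 1 / 2 <= ln (2 : R) by have := @ln_ge_subV R 2 (ltr0n R 2); lra.
have l2m : ln (2 : R) <= ln m%:R by rewrite ler_ln ?posrE// ler_nat.
have -> : (4 ^ m = 2 ^ (2 * m))%N by rewrite expnM.
rewrite !natrM !natrX !natrM.
have pn k x : 0 < x -> 0 < x ^+ k :> R by move=> ?; rewrite exprn_gt0.
rewrite !lnM ?posrE ?mulr_gt0 ?pn ?mulr_gt0//.
rewrite !lnXn ?mulr_gt0// lnM ?posrE// -![ln _ *+ _]mulr_natl.
rewrite -[(_ + _) *+ d]mulr_natl [(3 * d + 7)%:R]natrD [(3 * d)%:R]natrM [(2 * m)%:R]natrM.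
move: fle l2 l2m; move: (ln (2 : R)) (ln (m%:R : R)) (ln _) => u v w fle l2 l2m.
have := ler_wpM2l (ler0n R d) l2m.
move: (m%:R : R) (d%:R : R) fle => M D; lra.
Qed.

End asymptotics.

Unset Implicit Arguments.

Theorem theorem4 (R : realType) (d : nat) (hd : (1 <= d)%N)
    (lambda1 : nat -> R)
    (hlambda1 : forall m : nat, (1 <= m)%N ->
       first_dirichlet_eigenvalue d m (lambda1 m)) :
  (fun m : nat => lambda1 m `^ (1 / (2 * m)%:R)) =
  (fun m : nat => (2 * m)%:R / expR 1) +O_\oo (fun m : nat => ln (m%:R : R)).
Proof.
case: d hd hlambda1 => // n _ hlambda1.
pose C : R := (3 * n.+1 + 7)%:R.
apply/eqaddOP; near=> k.
(* The threshold is the condition 4 C^2 <= m; it also ensures m > 1 and 4 (d + 1) <= m. *)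
exists (4 * (3 * n.+1 + 7) ^ 2)%N => // m /= Nm.
have m1 : (1 < m)%N by apply: leq_trans Nm; rewrite expnS expn1; lia.
have hm := hlambda1 m (ltnW m1).
have lam_ge := dirichlet_eigenvalue_ge hm.1.
have l0 : 0 < lambda1 m by apply: lt_le_trans lam_ge; rewrite ltr0n fact_gt0.
have lnm0 : 0 <= ln (m%:R : R) by rewrite ln_ge0// ler1n ltnW.
have lo := root_factorial_ge (ltnW m1) lam_ge.
have hi : lambda1 m `^ (1 / (2 * m)%:R) <= (2 * m)%:R / expR 1 + C * ln m%:R.
  apply: root_le_of_poly_bound => //.
    by rewrite /C -natrX -natrM ler_nat.
  apply: le_trans (ln_poly_bound R n.+1 m1); rewrite ler_ln ?posrE//.
    by apply: (first_eigenvalue_nat_le hm); apply: leq_trans Nm; rewrite expnS expn1; lia.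
  by rewrite -natrM ltr0n !(muln_gt0, expn_gt0, fact_gt0) (ltnW m1).
rewrite [(_ - _) m]/(_ - _) ger0_norm ?subr_ge0// [`|ln _|]ger0_norm//.
apply: (@le_trans _ _ (C * ln m%:R)); first by rewrite lerBlDl.
by rewrite ler_wpM2r//; near: k; apply: nbhs_pinfty_ge; exact: num_real.
Unshelve. all: by end_near. Qed.
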